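(* Let $G$ be a VZ $2$-group. Let $m_1$, $m_2$ and $m_3$ denote the exponents of $G/G'$, $Z(G)$ and $Z(G)/G'$, respectively. Let $k=|\{\chi\in \mathrm{nl}(G) : m_{\mathbb{Q}}(\chi)=2\}|$, and let $\mathbb{H}(\mathbb{Q})$ be the quaternion algebra over $\mathbb{Q}$. Then the Wedderburn decomposition of $\mathbb{Q}G$ is $$\begin{aligned}\mathbb{Q}G \cong\ &\bigoplus_{d_1\mid m_1}a_{d_1}\mathbb{Q}(\zeta_{d_1})\ \oplus\ kM_{\frac{1}{2}|G/Z(G)|^{1/2}}(\mathbb{H}(\mathbb{Q}))\ \oplus\ (a_2-a_2'-k)M_{|G/Z(G)|^{1/2}}(\mathbb{Q})\\ &\oplus\bigoplus_{\substack{d_2\ge 4\\ d_2\mid m_2,\ d_2 \nmid m_3}} a_{d_2}M_{|G/Z(G)|^{1/2}}(\mathbb{Q}(\zeta_{d_2}))\ \oplus\bigoplus_{\substack{d_2\ge 4\\ d_2\mid m_2,\ d_2 \mid m_3}}(a_{d_2}-a_{d_2}')M_{|G/Z(G)|^{1/2}}(\mathbb{Q}(\zeta_{d_2})),\end{aligned}$$ where $a_{d_1}$ (in the first sum) is the number of cyclic subgroups of $G/G'$ of order $d_1$, and for $l=2$ and $l=d_2\ge 4$, $a_l$ is the number of cyclic subgroups of $Z(G)$ of order $l$ and $a_l'$ is the number of cyclic subgroups of $Z(G)/G'$ of order $l$.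
   Context: A finite group $G$ is a VZ-group if every non-linear irreducible complex character of $G$ vanishes on $G\setminus Z(G)$; then $G'\subseteq Z(G)$ and $|G/Z(G)|$ is a perfect square. A VZ $2$-group is a VZ-group that is a $2$-group. $\mathrm{nl}(G)$ is the set of irreducible complex characters of $G$ of degree $\neq 1$. $m_{\mathbb{Q}}(\chi)$ is the Schur index of $\chi$ over $\mathbb{Q}$ (the minimum of $[\mathbb{L}:\mathbb{Q}(\chi)]$ over fields $\mathbb{L}\supseteq\mathbb{Q}(\chi)$ over which a representation affording $\chi$ is realizable). $\mathbb{H}(\mathbb{Q})$ is the $\mathbb{Q}$-algebra with basis $1,i,j,ij$ and $i^2=j^2=-1$, $ij=-ji$. $\zeta_d$ is a primitive $d$-th root of unity, $M_n(D)$ the ring of $n\times n$ matrices over $D$, and for an integer $a\ge0$, $aR$ denotes the direct sum of $a$ copies of the algebra $R$ (a term with multiplicity $0$ is absent). *)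

(* Defs.v *)
From HB Require Import structures.
From mathcomp Require Import all_boot all_order all_fingroup all_algebra.
From mathcomp Require Import all_solvable all_field all_character.
From mathcomp Require Import boolp.
From mathcomp Require Import ring.

Set Implicit Arguments.
Unset Strict Implicit.
Unset Printing Implicit Defensive.

Import GroupScope GRing.Theory.
Local Open Scope ring_scope.

Section GroupAlgebra.

Variables (F : comNzRingType) (gT : finGroupType).

Definition galg : Type := {ffun gT -> F}.

HB.instance Definition _ := GRing.Lmodule.copy galg {ffun gT -> F^o}.

Implicit Types u v w : galg.

Definition galg_one : galg := [ffun x => (x == 1%g)%:R].

Definition galg_mul u v : galg := [ffun x => \sum_y u y * v (y^-1 * x)%g].

Fact galg_mulA : associative galg_mul.
Proof.
move=> u v w; apply/ffunP => x; rewrite !ffunE.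
transitivity (\sum_y \sum_z u y * v (y^-1 * z)%g * w (z^-1 * x)%g).
  apply: eq_bigr => y _; rewrite ffunE mulr_sumr.
  rewrite (reindex_inj (mulgI y^-1%g)) /=; apply: eq_bigr => z _.
  by rewrite mulrA invMg invgK -mulgA mulKVg.
rewrite exchange_big; apply: eq_bigr => z _.
by rewrite ffunE mulr_suml.
Qed.

Fact galg_mul1l : left_id galg_one galg_mul.
Proof.
move=> u; apply/ffunP => x; rewrite ffunE (bigD1 1%g) //= ffunE eqxx mul1r.
rewrite invg1 mul1g big1 ?addr0 // => y /negPf ny.
by rewrite ffunE ny mul0r.
Qed.

Fact galg_mul1r : right_id galg_one galg_mul.
Proof.
move=> u; apply/ffunP => x; rewrite ffunE (bigD1 x) //= ffunE mulVg eqxx mulr1.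
rewrite big1 ?addr0 // => y /negPf ny; rewrite ffunE.
by rewrite -eq_invg_mul invgK ny mulr0.
Qed.

Fact galg_mulDl : left_distributive galg_mul +%R.
Proof.
move=> u v w; apply/ffunP => x; rewrite !ffunE -big_split /=.
by apply: eq_bigr => y _; rewrite ffunE mulrDl.
Qed.

Fact galg_mulDr : right_distributive galg_mul +%R.
Proof.
move=> u v w; apply/ffunP => x; rewrite !ffunE -big_split /=.
by apply: eq_bigr => y _; rewrite ffunE mulrDr.
Qed.

Fact galg_one_neq0 : galg_one != 0.
Proof.
by apply/eqP => /ffunP/(_ 1%g)/eqP; rewrite !ffunE eqxx oner_eq0.
Qed.

HB.instance Definition _ := GRing.Zmodule_isNzRing.Build galg
  galg_mulA galg_mul1l galg_mul1r galg_mulDl galg_mulDr galg_one_neq0.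

Fact galg_scaleAl (a : F) u v : a *: (u * v) = (a *: u) * v.
Proof.
apply/ffunP => x; rewrite !ffunE scaler_sumr.
by apply: eq_bigr => y _; rewrite ffunE scalerAl.
Qed.

HB.instance Definition _ := GRing.Lmodule_isLalgebra.Build F galg galg_scaleAl.

Fact galg_scaleAr (a : F) u v : a *: (u * v) = u * (a *: v).
Proof.
apply/ffunP => x; rewrite !ffunE scaler_sumr.
by apply: eq_bigr => y _; rewrite ffunE scalerAr.
Qed.

HB.instance Definition _ :=
  GRing.Lalgebra_isAlgebra.Build F galg galg_scaleAr.

End GroupAlgebra.

Section MatrixAlgebra.

Variables (F : comNzRingType) (n : nat) (A : algType F).

(* The library makes 'M[A]_n an algebra over A only. The size n.-1.+1 is n    *)
(* for n > 0; it keeps the ring non-trivial when n = 0.                       *)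
Definition mxalg : Type := 'M[A]_n.-1.+1.

HB.instance Definition _ := GRing.NzRing.copy mxalg 'M[A]_n.-1.+1.

Implicit Types M N : mxalg.

Definition mxalg_scale (a : F) M : mxalg := map_mx (fun x : A => a *: x) M.

Fact mxalg_scaleA a b M :
  mxalg_scale a (mxalg_scale b M) = mxalg_scale (a * b) M.
Proof. by apply/matrixP => i j; rewrite !mxE scalerA. Qed.

Fact mxalg_scale1 : left_id 1 mxalg_scale.
Proof. by move=> M; apply/matrixP => i j; rewrite !mxE scale1r. Qed.

Fact mxalg_scaleDr : right_distributive mxalg_scale +%R.
Proof. by move=> a M N; apply/matrixP => i j; rewrite !mxE scalerDr. Qed.

Fact mxalg_scaleDl M : {morph mxalg_scale^~ M : a b / a + b}.
Proof. by move=> a b; apply/matrixP => i j; rewrite !mxE scalerDl. Qed.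

HB.instance Definition _ := GRing.Zmodule_isLmodule.Build F mxalg
  mxalg_scaleA mxalg_scale1 mxalg_scaleDr mxalg_scaleDl.

Fact mxalg_scaleAl (a : F) M N : a *: (M * N) = (a *: M) * N.
Proof.
apply/matrixP => i j; rewrite !mxE scaler_sumr.
by apply: eq_bigr => l _; rewrite mxE scalerAl.
Qed.

HB.instance Definition _ :=
  GRing.Lmodule_isLalgebra.Build F mxalg mxalg_scaleAl.

Fact mxalg_scaleAr (a : F) M N : a *: (M * N) = M * (a *: N).
Proof.
apply/matrixP => i j; rewrite !mxE scaler_sumr.
by apply: eq_bigr => l _; rewrite mxE scalerAr.
Qed.

HB.instance Definition _ :=
  GRing.Lalgebra_isAlgebra.Build F mxalg mxalg_scaleAr.

End MatrixAlgebra.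

Section Quaternions.

Variable F : comNzRingType.

(* Quat a b c d is a + b i + c j + d ij. *)
Record quat : Type := Quat { quat_re : F; quat_i : F; quat_j : F; quat_k : F }.

Definition quat_to_prod (q : quat) : F * F * F * F :=
  (quat_re q, quat_i q, quat_j q, quat_k q).
Definition quat_of_prod (t : F * F * F * F) : quat :=
  let: (a, b, c, d) := t in Quat a b c d.
Fact quat_to_prodK : cancel quat_to_prod quat_of_prod.
Proof. by case. Qed.

HB.instance Definition _ := Choice.copy quat (can_type quat_to_prodK).

Implicit Types p q r : quat.

Definition quat_add p q : quat :=
  let: Quat a1 b1 c1 d1 := p in
  let: Quat a2 b2 c2 d2 := q in
  Quat (a1 + a2) (b1 + b2) (c1 + c2) (d1 + d2).

Definition quat_opp q : quat :=
  let: Quat a b c d := q in Quat (- a) (- b) (- c) (- d).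

Definition quat_mul p q : quat :=
  let: Quat a1 b1 c1 d1 := p in
  let: Quat a2 b2 c2 d2 := q in
  Quat (a1 * a2 - b1 * b2 - c1 * c2 - d1 * d2)
       (a1 * b2 + b1 * a2 + c1 * d2 - d1 * c2)
       (a1 * c2 - b1 * d2 + c1 * a2 + d1 * b2)
       (a1 * d2 + b1 * c2 - c1 * b2 + d1 * a2).

Definition quat_scale (x : F) q : quat :=
  let: Quat a b c d := q in Quat (x * a) (x * b) (x * c) (x * d).

Fact quat_addA : associative quat_add.
Proof. by do 3!case=> ? ? ? ?; congr Quat; rewrite addrA. Qed.
Fact quat_addC : commutative quat_add.
Proof. by do 2!case=> ? ? ? ?; congr Quat; rewrite addrC. Qed.
Fact quat_add0 : left_id (Quat 0 0 0 0) quat_add.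
Proof. by case=> ? ? ? ?; congr Quat; rewrite add0r. Qed.
Fact quat_addN : left_inverse (Quat 0 0 0 0) quat_opp quat_add.
Proof. by case=> ? ? ? ?; congr Quat; rewrite addNr. Qed.

HB.instance Definition _ := GRing.isZmodule.Build quat
  quat_addA quat_addC quat_add0 quat_addN.

Fact quat_mulA : associative quat_mul.
Proof. by do 3!case=> ? ? ? ?; congr Quat; rewrite /=; ring. Qed.
Fact quat_mul1l : left_id (Quat 1 0 0 0) quat_mul.
Proof. by case=> ? ? ? ?; congr Quat; rewrite /=; ring. Qed.
Fact quat_mul1r : right_id (Quat 1 0 0 0) quat_mul.
Proof. by case=> ? ? ? ?; congr Quat; rewrite /=; ring. Qed.
Fact quat_mulDl : left_distributive quat_mul quat_add.
Proof. by do 3!case=> ? ? ? ?; congr Quat; rewrite /=; ring. Qed.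
Fact quat_mulDr : right_distributive quat_mul quat_add.
Proof. by do 3!case=> ? ? ? ?; congr Quat; rewrite /=; ring. Qed.
Fact quat_one_neq0 : Quat 1 0 0 0 != 0.
Proof. by apply/eqP => -[] /eqP; rewrite oner_eq0. Qed.

HB.instance Definition _ := GRing.Zmodule_isNzRing.Build quat
  quat_mulA quat_mul1l quat_mul1r quat_mulDl quat_mulDr quat_one_neq0.

Fact quat_scaleA x y q : quat_scale x (quat_scale y q) = quat_scale (x * y) q.
Proof. by case: q => ? ? ? ?; congr Quat; rewrite /= mulrA. Qed.
Fact quat_scale1 : left_id 1 quat_scale.
Proof. by case=> ? ? ? ?; congr Quat; rewrite mul1r. Qed.
Fact quat_scaleDr : right_distributive quat_scale quat_add.
Proof. by move=> x; do 2!case=> ? ? ? ?; congr Quat; rewrite /= mulrDr. Qed.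
Fact quat_scaleDl q : {morph quat_scale^~ q : x y / x + y >-> quat_add x y}.
Proof. by move=> x y; case: q => ? ? ? ?; congr Quat; rewrite /= mulrDl. Qed.

HB.instance Definition _ := GRing.Zmodule_isLmodule.Build F quat
  quat_scaleA quat_scale1 quat_scaleDr quat_scaleDl.

Fact quat_scaleAl x p q :
  quat_scale x (quat_mul p q) = quat_mul (quat_scale x p) q.
Proof. by case: p q => ? ? ? ? [? ? ? ?]; congr Quat; rewrite /=; ring. Qed.

HB.instance Definition _ := GRing.Lmodule_isLalgebra.Build F quat quat_scaleAl.

Fact quat_scaleAr x p q :
  quat_scale x (quat_mul p q) = quat_mul p (quat_scale x q).
Proof. by case: p q => ? ? ? ? [? ? ? ?]; congr Quat; rewrite /=; ring. Qed.

HB.instance Definition _ :=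
  GRing.Lalgebra_isAlgebra.Build F quat quat_scaleAr.

End Quaternions.

(* The zero algebra when s is empty, hence no algType instance. The default   *)
(* F^o of nth is never reached.                                               *)
Section DirectSum.

Variables (F : comNzRingType) (s : seq (algType F)).

Definition dsum : Type :=
  {dffun forall i : 'I_(size s), nth (F^o : algType F) s i}.

HB.instance Definition _ := Choice.on dsum.

Implicit Types u v w : dsum.

Definition dsum_zero : dsum := [ffun i => 0].
Definition dsum_opp u : dsum := [ffun i => - u i].
Definition dsum_add u v : dsum := [ffun i => u i + v i].
Definition dsum_one : dsum := [ffun i => 1].
Definition dsum_mul u v : dsum := [ffun i => u i * v i].
Definition dsum_scale (a : F) u : dsum := [ffun i => a *: u i].

Fact dsum_addA : associative dsum_add.
Proof. by move=> u v w; apply/ffunP => i; rewrite !ffunE addrA. Qed.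
Fact dsum_addC : commutative dsum_add.
Proof. by move=> u v; apply/ffunP => i; rewrite !ffunE addrC. Qed.
Fact dsum_add0 : left_id dsum_zero dsum_add.
Proof. by move=> u; apply/ffunP => i; rewrite !ffunE add0r. Qed.
Fact dsum_addN : left_inverse dsum_zero dsum_opp dsum_add.
Proof. by move=> u; apply/ffunP => i; rewrite !ffunE addNr. Qed.

HB.instance Definition _ := GRing.isZmodule.Build dsum
  dsum_addA dsum_addC dsum_add0 dsum_addN.

Fact dsum_mulA : associative dsum_mul.
Proof. by move=> u v w; apply/ffunP => i; rewrite !ffunE mulrA. Qed.
Fact dsum_mul1l : left_id dsum_one dsum_mul.
Proof. by move=> u; apply/ffunP => i; rewrite !ffunE mul1r. Qed.
Fact dsum_mul1r : right_id dsum_one dsum_mul.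
Proof. by move=> u; apply/ffunP => i; rewrite !ffunE mulr1. Qed.
Fact dsum_mulDl : left_distributive dsum_mul +%R.
Proof. by move=> u v w; apply/ffunP => i; rewrite !ffunE mulrDl. Qed.
Fact dsum_mulDr : right_distributive dsum_mul +%R.
Proof. by move=> u v w; apply/ffunP => i; rewrite !ffunE mulrDr. Qed.

HB.instance Definition _ := GRing.Zmodule_isPzRing.Build dsum
  dsum_mulA dsum_mul1l dsum_mul1r dsum_mulDl dsum_mulDr.

Fact dsum_scaleA a b u : dsum_scale a (dsum_scale b u) = dsum_scale (a * b) u.
Proof. by apply/ffunP => i; rewrite !ffunE scalerA. Qed.
Fact dsum_scale1 : left_id 1 dsum_scale.
Proof. by move=> u; apply/ffunP => i; rewrite !ffunE scale1r. Qed.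
Fact dsum_scaleDr : right_distributive dsum_scale +%R.
Proof. by move=> a u v; apply/ffunP => i; rewrite !ffunE scalerDr. Qed.
Fact dsum_scaleDl u : {morph dsum_scale^~ u : a b / a + b}.
Proof. by move=> a b; apply/ffunP => i; rewrite !ffunE scalerDl. Qed.

HB.instance Definition _ := GRing.Zmodule_isLmodule.Build F dsum
  dsum_scaleA dsum_scale1 dsum_scaleDr dsum_scaleDl.

End DirectSum.

Definition copies (F : comNzRingType) (a : nat) (A : algType F) :
  seq (algType F) := nseq a A.

Definition isomorphic_to_dsum (F : comNzRingType) (A : algType F)
    (s : seq (algType F)) : Prop :=
  exists f : A -> dsum s, [/\ linear f, monoid_morphism f & bijective f].

Section Cyclotomic.

Variable d : nat.

Definition zetaC : algC := sval (C_prim_root_exists (ltn0Sn d.-1)).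

(* Only meaningful for d > 0. *)
Definition Qzeta : fieldExtType rat := tag (num_field_exists [:: zetaC]).

Lemma QzetaP :
  (0 < d)%N -> exists2 z : Qzeta, d.-primitive_root z & <<1; z>>%VS = fullv.
Proof.
rewrite /Qzeta; case: num_field_exists => Q [QC [[|z [|//]] //= [Dz] genz]] d_gt0.
exists z; last by rewrite -genz adjoin_seq1.
rewrite -(fmorph_primitive_root QC) Dz -{1}(prednK d_gt0) /zetaC.
by case: C_prim_root_exists.
Qed.

End Cyclotomic.

Section SchurIndex.

Variables (gT : finGroupType) (G : {group gT}).

(* m = [L : Q(chi)] for a number field L over which chi is realizable: iota   *)
(* embeds L in algC, and <<1 & s>> is Q(chi) seen in L. The minimum over all  *)
(* fields containing Q(chi) is reached by such an L.                          *)
Definition realizable_in_degree (chi : 'CF(G)) (m : nat) : Prop :=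
  exists (L : fieldExtType rat) (iota : {rmorphism L -> algC})
         (n : nat) (rG : mx_representation L G n) (s : seq L),
    [/\ cfRepr (map_repr iota rG) = chi,
        [seq iota x | x <- s] = [seq chi x | x <- enum G]
      & m = \dim_(<<1 & s>>) {:L}].

Lemma irr_realizable (i : Iirr G) :
  exists m, `[< realizable_in_degree 'chi_i m >].
Proof.
have /char_reprP[[n rG] Dchi] := irr_char i.
pose entries := [seq rG p.1 p.2.1 p.2.2 | p : gT * ('I_n * 'I_n)].
have [L [iota [s1 Ds1 _]]] := num_field_exists entries.
pose h x := s1`_(index x entries).
have hK x : x \in entries -> iota (h x) = x.
  move=> s_x; rewrite /h -(nth_map _ 0 iota); last first.
    by rewrite -(size_map iota) Ds1 index_mem.
  by rewrite Ds1 nth_index.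
pose rL g := map_mx h (rG g).
have rLK g : map_mx iota (rL g) = rG g.
  apply/matrixP => j k; rewrite !mxE hK //.
  by apply/mapP; exists (g, (j, k)) => //; rewrite mem_enum.
have rL_repr : mx_repr G rL.
  split=> [|x y Gx Gy]; apply: (map_mx_inj (f := iota)).
    by rewrite rLK map_mx1 repr_mx1.
  by rewrite map_mxM !rLK repr_mxM.
pose s := [seq \tr (rL g) | g <- enum G].
exists (\dim_(<<1 & s>>) {:L})%N; apply/asboolP.
exists L, iota, n, (MxRepresentation rL_repr), s; split=> //.
  rewrite Dchi; apply/cfun_inP => x Gx.
  by rewrite !cfunE Gx -rLK.
rewrite -map_comp; apply/eq_in_map => x; rewrite mem_enum => Gx /=.
by rewrite Dchi cfunE Gx -trace_map_mx rLK.
Qed.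

Definition schur_index (i : Iirr G) : nat := ex_minn (irr_realizable i).

End SchurIndex.

Section VZGroups.

Variables (gT : finGroupType) (G : {group gT}).

Definition nl : {set Iirr G} := [set i | 'chi_i 1%g != 1].

Definition VZ_group : Prop :=
  forall i, i \in nl -> {in G :\: 'Z(G), forall x, 'chi_i x = 0}.

Definition nb_cyclic (A : {set gT}) (d : nat) : nat :=
  #|[set C : {group gT} | [&& C \subset A, cyclic C & #|C| == d]]|.

End VZGroups.

(* Main.v *)
From HB Require Import structures.
Require Import Defs.
From mathcomp Require Import all_boot all_order all_fingroup all_algebra.
From mathcomp Require Import all_solvable all_field all_character.
From mathcomp Require Import boolp ring.

Set Implicit Arguments.
Unset Strict Implicit.
Unset Printing Implicit Defensive.

Import Order.TTheory GRing.Theory Num.Theory GroupScope.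
Local Open Scope ring_scope.

(** The simple factors of [QG] correspond to the Galois classes of irreducible characters, so
    the proof counts these classes and finds, for one character of each class, a
    representation over the expected division algebra.

    The factors of linear characters are cyclotomic fields. An abelian group and its dual
    have as many elements of each order ([card_irr_order]), and a Galois class of linear
    characters of order [d] has [totient d] elements; this gives the first sum.

    A non-linear character [chi] of a VZ-group is determined by its central character
    [lam], any linear character of [Z = 'Z(G)] that is not trivial on [G'] occurs, and the
    degree of [chi] is the square root [n] of [#|G : Z|]; so the classes with [lam] of order
    [d] are counted by the cyclic subgroups of order [d] of [Z] and of [Z / G']
    ([card_nl_order_add]). The map [(x, y) |-> lam [~ x, y]] is bimultiplicative on [G], with
    radical [Z]. Let [K] be maximal among the subgroups of [G] that meet [Z] in the kernel of
    [lam], and let [Kperp] be its orthogonal. Then [lam] extends to [Z * K], trivially on [K],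
    with the same values, and [Z * K] is the orthogonal of [Kperp] ([perp_perp]). By
    maximality, when [x] is in [Kperp] but not in [Z * K] and [x ^ 2 = z * k], the value
    [lam z] is not the square of a value of [lam] ([sqr_lam_sqr]).
    - If 4 divides the order [d] of [lam], then -1 is the square of a value of [lam], which
      leaves no room for two involutions of [Kperp / (Z * K)], and forces [Kperp = Z * K]
      ([Kperp_eq_ZK]). Inducing the extension of [lam] then realizes [chi] over its field of
      values [Q(zeta_d)], in degree [#|G : Z * K| = n].
    - If [d = 2], then either [Kperp = Z * K] again, and [chi] is realized over [Q], or
      [Kperp] is generated by [Z * K] and two anticommuting elements [g], [h] such that [lam]
      is -1 at [g ^ 2] and [h ^ 2]. In the latter case [lam] extends to a homomorphism from
      [Kperp] to the rational quaternions ([quat_homM]), which induces a homomorphism from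
      [G] to the quaternion matrices of size [n./2]; and the Schur index of [chi] is 2,
      because a rational representation affording [chi] would restrict to a rational
      representation of degree 2 of the quaternion group ([quat_not_realizable]).

    That the induced representations afford [chi] is seen on the centre: a trace with the
    right restriction to the centre vanishes elsewhere ([ind_mx_trace]). The resulting algebra
    morphisms are jointly injective, as they see every irreducible character, and
    comparing dimensions shows that they form an isomorphism ([isomorphic_of_realizes]). *)

(** * Linear characters of given order *)

Lemma card_by_divisors (T : finType) (f : T -> nat) (d : nat) : (0 < d)%N ->
  #|[set x | (f x %| d)%N]| = (\sum_(e <- divisors d) #|[set x | f x == e]|)%N.
Proof.
move=> d_gt0; rewrite -sum1_card.
under [RHS]eq_bigr do rewrite -sum1_card big_mkcond /=.
rewrite exchange_big [LHS]big_mkcond /=; apply: eq_bigr => x _.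
rewrite inE dvdn_divisors //.
case: ifPn => [dfx|ndfx].
  rewrite (bigD1_seq (f x)) ?divisors_uniq //= inE eqxx big1 ?addn0 // => e.
  by rewrite inE eq_sym => /negPf->.
rewrite big1_seq // => e /= de; rewrite inE; case: eqP => // fe.
by rewrite fe de in ndfx.
Qed.

(** Uniqueness of Moebius inversion over the divisors. *)
Lemma eq_card_fibre (T U : finType) (f : T -> nat) (g : U -> nat) :
    (forall d, (0 < d)%N ->
       #|[set x | (f x %| d)%N]| = #|[set y | (g y %| d)%N]|) ->
  forall d, (0 < d)%N -> #|[set x | f x == d]| = #|[set y | g y == d]|.
Proof.
move=> fg d; have [m] := ubnP d; elim: m d => // m IH d ltdm d_gt0.
have := fg d d_gt0; rewrite !card_by_divisors //.
have dd : d \in divisors d by rewrite -dvdn_divisors.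
rewrite !(bigD1_seq d) ?divisors_uniq //=.
set s1 := (\sum_(_ <- _ | _) _)%N; set s2 := (\sum_(_ <- _ | _) _)%N.
suff -> : s1 = s2 by move/addIn.
rewrite /s1 /s2 big_seq_cond [RHS]big_seq_cond; apply: eq_bigr => e.
rewrite -dvdn_divisors // => /andP[de ne].
have e_gt0 := dvdn_gt0 d_gt0 de.
apply: IH => //; rewrite -ltnS (leq_trans _ ltdm) // !ltnS ltn_neqAle ne; exact: dvdn_leq.
Qed.

Lemma card_order_nb_cyclic (gT : finGroupType) (A : {group gT}) (d : nat) :
  #|[set x in A | #[x]%g == d]| = (totient d * nb_cyclic A d)%N.
Proof.
pose cyc := [set C : {group gT} | [&& C \subset A, cyclic C & #|C| == d]].
rewrite -sum1_card (partition_big (fun x => <[x]>%G) (mem cyc)) /=; last first.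
  by move=> x; rewrite !inE cycle_subG cycle_cyclic.
rewrite mulnC /nb_cyclic -sum_nat_const; apply: eq_bigr => C.
rewrite inE => /and3P[sCA /cyclicP[x defC] /eqP oC].
rewrite -oC defC -[#|<[x]>|]/(#[x]%g) totient_gen -sum1_card; apply: eq_bigl => y.
rewrite !inE -val_eqE /= defC /generator.
have sxA : <[x]> \subset A by rewrite -defC.
apply/idP/idP => [/andP[_ /eqP->] //|/eqP xy].
by rewrite -xy eqxx -cycle_subG -xy sxA orderE -xy eqxx.
Qed.

Lemma card_irr_ker (gT : finGroupType) (H N : {group gT}) (P : pred 'CF(H)) :
    N <| H ->
  #|[set i : Iirr H | (N \subset cfker 'chi_i) && P 'chi_i]|
    = #|[set i : Iirr (H / N) | P ('chi_i %% N)%CF]|.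
Proof.
move=> nNH; rewrite -(card_imset _ (can_inj (mod_IirrK nNH))).
apply: eq_card => i; rewrite inE; apply/andP/imsetP => [[kerN Pi]|[j]].
  exists (quo_Iirr N i); last by rewrite quo_IirrK.
  by rewrite inE -mod_IirrE // quo_IirrK.
by rewrite inE => Pj ->; rewrite mod_IirrE // cfker_mod.
Qed.

Section PowerMap.

Variables (gT : finGroupType) (A : {group gT}) (d : nat).
Hypothesis cAA : abelian A.

Let powd (x : gT) := (x ^+ d)%g.

Let powdM : {in A &, {morph powd : x y / (x * y)%g}}.
Proof. by move=> x y Ax Ay; apply: expgMn; apply: (centsP cAA). Qed.

(** Both sides are the order of the kernel of [x |-> x ^ d]: a character is killed by [d] when it
    is trivial on the image of this map, and the index of the image is the order of the kernel. *)
Lemma card_irr_exp : 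
  #|[set i : Iirr A | (#['chi_i]%CF %| d)%N]| = #|[set x in A | (#[x]%g %| d)%N]|.
Proof.
pose f := Morphism powdM.
have sfA : f @* A \subset A.
  by apply/subsetP=> _ /morphimP[x _ Ax ->]; apply: groupX.
have nfA : f @* A <| A by rewrite /(_ <| _) sfA sub_abelian_norm.
transitivity #|[set i : Iirr A | (f @* A \subset cfker 'chi_i) && true]|.
  apply: eq_card => i; rewrite !inE andbT.
  have lini : 'chi_i \is a linear_char by apply/char_abelianP.
  apply/dvdn_cforderP/subsetP => [chi1 _ /morphimP[x _ Ax ->]|kerA x Ax].
    by rewrite cfkerEirr inE lin_charX // (chi1 x Ax) lin_char1.
  have /kerA : f x \in f @* A by apply: mem_morphim.
  by rewrite cfkerEirr inE lin_charX // lin_char1 // => /eqP.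
rewrite (card_irr_ker (fun=> true)) //.
rewrite (eq_card (B := Iirr (A / f @* A))) => [|i]; last by rewrite !inE.
rewrite card_Iirr_abelian ?quotient_abelian // card_quotient ?normal_norm //.
have: (#|A : 'ker f| * #|'ker f| = #|A|)%N.
  by rewrite mulnC Lagrange // subIset // subxx.
rewrite -(Lagrange sfA) card_morphim setIid [RHS]mulnC => /eqP.
rewrite [X in X == _]mulnC eqn_pmul2r ?indexg_gt0 // => /eqP <-.
by apply: eq_card => x; rewrite !inE order_dvdn.
Qed.

End PowerMap.

(** Elements and characters of order exactly [d] are counted by inversion from those that are
    killed by [d], for which duality is [card_irr_exp]. *)
Lemma card_irr_order (gT : finGroupType) (A : {group gT}) (d : nat) :
    abelian A -> (0 < d)%N ->
  #|[set i : Iirr A | #['chi_i]%CF == d]| = (totient d * nb_cyclic A d)%N.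
Proof.
move=> cAA d_gt0; rewrite -card_order_nb_cyclic.
pose g (x : gT) := if x \in A then #[x]%g else 0%N.
transitivity #|[set x | g x == d]|; last first.
  apply: eq_card => x; rewrite !inE /g; case: ifP => //= _.
  by case: d d_gt0.
apply: (eq_card_fibre (f := fun i : Iirr A => #['chi_i]%CF)) => // e e_gt0.
rewrite card_irr_exp //; apply: eq_card => x; rewrite !inE /g; case: ifP => //= _.
by case: e e_gt0.
Qed.

Lemma card_irr_ker_order (gT : finGroupType) (H N : {group gT}) (d : nat) :
    N <| H -> abelian (H / N)%g -> (0 < d)%N ->
  #|[set i : Iirr H | (N \subset cfker 'chi_i) && (#['chi_i]%CF == d)]|
    = (totient d * nb_cyclic (H / N)%g d)%N.
Proof.
move=> nNH cHN d_gt0; rewrite (card_irr_ker (fun phi => #[phi]%CF == d)) //.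
rewrite -card_irr_order //; apply: eq_card => i.
by rewrite !inE cforder_mod.
Qed.

Lemma nb_cyclic_exponent (gT : finGroupType) (A : {group gT}) (d : nat) :
  (0 < nb_cyclic A d)%N -> (d %| exponent A)%N.
Proof.
case/card_gt0P=> C; rewrite inE => /and3P[sCA /cyclicP[x defC] /eqP <-].
by rewrite defC; apply: dvdn_exponent; rewrite -cycle_subG -defC.
Qed.

(** * Central characters in a VZ-group *)

Section CentralCharacter.

Variables (gT : finGroupType) (G : {group gT}).

Lemma in_nl (i : Iirr G) : (i \in nl G) = ('chi_i \isn't a linear_char).
Proof. by rewrite inE qualifE /= irr_char. Qed.

Lemma central_character_exists (i : Iirr G) :
  exists j : Iirr 'Z(G), 'Res['Z(G)] 'chi_i == 'chi_i 1%g *: 'chi_j.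
Proof.
have [phi lin_phi res_phi] := cfcenter_Res 'chi_i.
have sZ : 'Z(G) \subset 'Z('chi_i)%CF.
  apply/subsetP=> z Zz; have Gz := subsetP (center_sub G) z Zz.
  by have := cap_cfcenter_irr G => /setP/(_ z); rewrite Zz => /bigcapP/(_ i isT).
have /irrP[j Dj] : 'Res['Z(G)] phi \in irr 'Z(G).
  by rewrite lin_char_irr ?cfRes_lin_char.
by exists j; rewrite -Dj -linearZ /= -res_phi cfResRes ?cfcenter_sub.
Qed.

Definition central_irr (i : Iirr G) : Iirr 'Z(G) := xchoose (central_character_exists i).

Lemma chi_center (i : Iirr G) (z : gT) :
  z \in 'Z(G) -> 'chi_i z = 'chi_i 1%g * 'chi_(central_irr i) z.
Proof.
move=> Zz; have /eqP/cfunP/(_ z) := xchooseP (central_character_exists i).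
by rewrite cfResE ?center_sub // cfunE.
Qed.

Lemma central_irr_lin (i : Iirr G) : 'chi_(central_irr i) \is a linear_char.
Proof. exact/char_abelianP/center_abelian. Qed.

End CentralCharacter.

Section VZ.

Variables (gT : finGroupType) (G : {group gT}).
Hypothesis vz : VZ_group G.

(** Only the linear characters contribute to column orthogonality at [g]; it makes the
    centralizer of [g] as large as [G / G'], hence the class of [g] as large as [G']. *)
Lemma vz_class (g : gT) : g \in G -> g \notin 'Z(G) -> (g ^: G = g *: G^`(1))%g.
Proof.
move=> Gg nZg; apply/eqP; rewrite eqEcard; apply/andP; split.
  apply/subsetP=> _ /imsetP[h Gh ->].
  by rewrite mem_lcoset; apply: mem_commg.
have := second_orthogonality_relation g Gg; rewrite class_refl mulr1n.
rewrite (bigID (fun i => i \in nl G)) /= big1 ?add0r => [|i nl_i]; last first.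
  by rewrite (vz nl_i) ?mul0r // inE nZg.
under eq_bigr => i nli.
  rewrite in_nl negbK in nli.
  rewrite -normCK normC_lin_char // expr1n; over.
rewrite sumr_const (eq_card (B := [pred i | 'chi[G]_i \is a linear_char])); last first.
  by move=> i; rewrite !inE -[LHS]/(i \notin nl G) in_nl negbK.
move/eqP; rewrite card_lin_irr eqr_nat => /eqP oC.
rewrite card_lcoset -index_cent1 -(leq_pmul2l (cardG_gt0 'C_G[g])).
by rewrite Lagrange ?subsetIl // -oC mulnC Lagrange ?der_sub.
Qed.

(** The class of a non-central element of [G'] would be [G'] itself, and contain 1. *)
Lemma vz_der_sub : G^`(1)%g \subset 'Z(G).
Proof.
apply/subsetP=> x G'x; apply/idPn=> nZx.
have Gx := subsetP (der_sub 1 G) x G'x.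
have : 1%g \in x ^: G.
  by rewrite vz_class // mem_lcoset mulg1 groupV.
rewrite class_sym class1G inE => /eqP x1.
by rewrite x1 group1 in nZx.
Qed.

(** If [g] is not central, then [g c] is a conjugate of [g] for all [c] in [G'], so all elements of
    [G'] are commutators [[~ g, h]] and the hypothesis puts [G'] in the kernel of [i]. *)
Lemma vz_nondegenerate (i : Iirr G) (g : gT) : i \in nl G -> g \in G ->
  (forall h, h \in G -> 'chi_(central_irr i) [~ g, h]%g = 1) -> g \in 'Z(G).
Proof.
move=> nl_i Gg triv; apply/idPn=> nZg.
suff : 'chi_i \is a linear_char by move=> lin; rewrite in_nl lin in nl_i.
rewrite lin_irr_der1; apply/subsetP=> c G'c.
have [h Gh Dh]: exists2 h, h \in G & (g * c = g ^ h)%g.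
  by apply/imsetP; rewrite -/(g ^: G) vz_class // mem_lcoset mulKg.
have -> : c = [~ g, h]%g by rewrite commgEl -Dh mulKg.
have Zgh : [~ g, h]%g \in 'Z(G).
  by apply: (subsetP vz_der_sub); rewrite mem_commg.
by rewrite cfkerEirr inE (chi_center i) // triv // mulr1 eqxx.
Qed.

(** The norm of [i] is a sum over the centre only. *)
Lemma vz_degree (i : Iirr G) :
  i \in nl G -> 'chi_i 1%g ^+ 2 = #|G : 'Z(G)|%:R.
Proof.
move=> nl_i; have := cfnorm_irr i; rewrite (cfnormE (cfun_onG _)).
rewrite (big_setID 'Z(G)) /= (setIidPr (center_sub G)).
rewrite [X in _ + X]big1 ?addr0 => [|x]; last first.
  by move=> xZ; rewrite (vz nl_i) // normr0 expr0n.
under eq_bigr => z Zz.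
  rewrite chi_center // normrM (normC_lin_char (central_irr_lin i) Zz) mulr1.
  rewrite ger0_norm ?char1_ge0 ?irr_char //; over.
rewrite sumr_const -(Lagrange (center_sub G)) natrM -[('chi_i _ ^+ 2) *+ _]mulr_natl.
have nzZ : #|'Z(G)|%:R != 0 :> algC by rewrite neq0CG.
have nzI : #|G : 'Z(G)|%:R != 0 :> algC by rewrite neq0CiG.
by rewrite invfM -mulrA mulrCA mulKf // => /(canRL (mulKf _))->; rewrite ?invr_eq0 // invrK mulr1.
Qed.

Lemma central_irr_der (i : Iirr G) :
  i \in nl G -> ~~ (G^`(1)%g \subset cfker 'chi_(central_irr i)).
Proof.
rewrite in_nl lin_irr_der1; apply: contra => sG'.
apply/subsetP=> c G'c; have Zc := subsetP vz_der_sub c G'c.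
have := subsetP sG' c G'c; rewrite !cfkerEirr !inE (chi_center i) // => /eqP->.
by rewrite (lin_char1 (central_irr_lin i)) mulr1.
Qed.

Lemma central_irr_inj : {in nl G &, injective (@central_irr gT G)}.
Proof.
move=> i j nl_i nl_j eq_ij; apply/irr_inj/cfun_inP=> x Gx.
have eq1 : 'chi_i 1%g = 'chi_j 1%g.
  by apply/eqP; rewrite -(@eqrXn2 _ 2) ?char1_ge0 ?irr_char // !vz_degree.
have [Zx|nZx] := boolP (x \in 'Z(G)); first by rewrite (chi_center i Zx) (chi_center j Zx) eq1 eq_ij.
by rewrite (vz nl_i) ?(vz nl_j) // inE nZx.
Qed.

Lemma central_irr_surj (j : Iirr 'Z(G)) : ~~ (G^`(1)%g \subset cfker 'chi_j) ->
  exists2 i, i \in nl G & central_irr i = j.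
Proof.
move=> nker; have nz : 'Ind[G] 'chi_j != 0 by rewrite Ind_irr_neq0 ?center_sub.
have [i] := neq0_has_constt nz; rewrite constt_Ind_Res => ij.
have Dj : central_irr i = j.
  have Dres : 'Res['Z(G)] 'chi_i = 'chi_i 1%g *: 'chi_(central_irr i).
    by apply/eqP; apply: (xchooseP (central_character_exists i)).
  apply: contraTeq ij => /negPf nij.
  by rewrite Dres irr_consttE cfdotZl cfdot_irr nij mulr0 eqxx.
exists i => //; rewrite in_nl; apply: contra nker; rewrite -Dj => lin_i.
apply/subsetP=> c G'c; have Zc := subsetP vz_der_sub c G'c.
have := subsetP (lin_char_der1 lin_i) c G'c.
by rewrite !cfkerEirr !inE (chi_center i) // !lin_char1 ?central_irr_lin // mul1r.
Qed.

(** [central_irr] is a bijection from [nl G] to the characters of ['Z(G)] that are not trivial on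
    [G'], and the others are the characters of ['Z(G) / G']. *)
Lemma card_nl_order_add (d : nat) : (0 < d)%N ->
  (#|[set i in nl G | #['chi_(central_irr i)]%CF == d]|
     + totient d * nb_cyclic ('Z(G) / G^`(1))%g d
   = totient d * nb_cyclic 'Z(G) d)%N.
Proof.
move=> d_gt0; have cZZ := center_abelian G.
have nG'Z : G^`(1)%g <| 'Z(G).
  by rewrite /normal vz_der_sub sub_abelian_norm // vz_der_sub.
rewrite -card_irr_ker_order ?quotient_abelian // -card_irr_order //.
rewrite -(card_in_imset (f := @central_irr gT G)); last first.
  by move=> i j; rewrite !inE => /andP[Hi _] /andP[Hj _]; apply: central_irr_inj; rewrite inE.
set X := [set x in _ | _]; set Y := [set i | _ & _].
rewrite -cardsUI [X in (_ + X)%N](_ : _ = 0%N) ?addn0; last first.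
  apply: eq_card0 => j; rewrite !inE; apply: contraTF isT => /andP[].
  by case/imsetP=> i; rewrite inE => /andP[nl_i _] -> /andP[]; rewrite (negPf (central_irr_der nl_i)).
apply: eq_card => j; rewrite !inE.
apply/orP/idP => [[/imsetP[i]|/andP[]//]|Dd]; first by rewrite inE => /andP[_ Hd] ->.
have [sG'|nsG'] := boolP (G^`(1)%g \subset cfker 'chi_j); first by right.
left; have [i nl_i Di] := central_irr_surj nsG'.
by apply/imsetP; exists i => //; rewrite inE nl_i Di.
Qed.

End VZ.

(** * The commutator form of a central character *)

(** The values of [xi] are roots of unity of order a power of [p]; if none had the order of
    [xi], then [xi] would be killed by a smaller power of [p]. *)
Lemma lin_char_prim_root (p : nat) (gT : finGroupType) (H : {group gT})
    (xi : 'CF(H)) : prime p -> p.-group H -> xi \is a linear_char ->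
  exists2 z, z \in H & #[xi]%CF.-primitive_root (xi z).
Proof.
move=> p_pr pH lin_xi.
have [k Dd]: exists k, #[xi]%CF = (p ^ k)%N.
  have [n Dn] := p_natP pH.
  have := cforder_lin_char_dvdG lin_xi; rewrite Dn.
  by case/(dvdn_pfactor _ _ p_pr) => k _ ->; exists k.
case: k Dd => [|k] Dd.
  exists 1%g; rewrite ?group1 // Dd expn0 lin_char1 //.
  by apply/andP; split=> //; apply/forallP=> j; rewrite ord1 unity_rootE expr1 !eqxx.
have: ~~ (#[xi]%CF %| p ^ k)%N by rewrite Dd pfactor_dvdn ?expn_gt0 ?prime_gt0 // pfactorK // ltnn.
move=> ndvd; have [z Hz nz]: exists2 z, z \in H & xi z ^+ (p ^ k) != 1.
  apply/exists_inP; apply: contraR ndvd; rewrite negb_exists_in => /forall_inP all1.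
  by apply/dvdn_cforderP=> z Hz; apply/eqP; have := all1 z Hz; rewrite negbK.
exists z => //; have z1 : xi z ^+ #[xi]%CF = 1 by apply/(dvdn_cforderP (dvdnn _)).
have d_gt0 := cforder_lin_char_gt0 lin_xi.
have [m prim_m dvd_m] := prim_order_exists d_gt0 z1.
suff <- : m = #[xi]%CF by [].
move: dvd_m; rewrite Dd => /(dvdn_pfactor _ _ p_pr)[j]; rewrite leq_eqVlt.
case/predU1P=> [-> //|]; rewrite ltnS => lejk Dm; case/negP: nz.
by rewrite -(prim_order_dvd prim_m) Dm dvdn_exp2l.
Qed.

(** Translation by [h] multiplies the sum by [f h]. *)
Lemma sum_hom_eq0 (gT : finGroupType) (H : {group gT}) (f : gT -> algC) (h : gT) :
    {in H &, {morph f : x y / (x * y)%g >-> x * y}} -> h \in H -> f h != 1 ->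
  \sum_(x in H) f x = 0.
Proof.
move=> fM Hh fh1; set s := \sum_(x in H) f x.
have: f h * s = s.
  rewrite mulr_sumr [RHS](reindex_inj (mulgI h)) /=.
  by apply: eq_big => x; [rewrite groupMl | move=> Hx; rewrite fM].
move/eqP; rewrite -subr_eq0 -{2}[s]mul1r -mulrBl mulf_eq0 subr_eq0 (negPf fh1).
by move/eqP.
Qed.

(** The values 1 and -1 cancel in the sum of [f]. *)
Lemma card_sign_ker (gT : finGroupType) (H : {group gT}) (f : gT -> algC) (h : gT) :
    {in H &, {morph f : x y / (x * y)%g >-> x * y}} ->
    (forall x, x \in H -> f x = 1 \/ f x = -1) -> h \in H -> f h = -1 ->
  #|H| = #|[set x in H | f x == 1]|.*2.
Proof.
move=> fM f1 Hh fh; have nm : (-1 : algC) == 1 = false.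
  by rewrite eq_sym -subr_eq0 opprK (eqr_nat _ 2 0).
have := sum_hom_eq0 fM Hh; rewrite fh nm => /(_ isT).
rewrite (bigID (fun x => f x == 1)) /=.
under eq_bigr => x /andP[_ /eqP->] do over.
under [X in _ + X]eq_bigr => x /andP[Hx nfx].
  have -> : f x = -1 by case: (f1 x Hx) nfx => [->|//]; rewrite eqxx.
  over.
rewrite !sumr_const mulNrn => /eqP; rewrite subr_eq0 eqr_nat => /eqP eqc.
rewrite -(cardsID [set x | f x == 1] H) -addnn; congr (_ + _)%N.
  by apply: eq_card => x; rewrite !inE.
transitivity #|[pred x in H | f x != 1]|; first by apply: eq_card => x; rewrite !inE andbC.
by rewrite -[LHS]eqc; apply: eq_card => x; rewrite !inE.
Qed.

Section Pairing.

Variables (gT : finGroupType) (G : {group gT}) (lam : 'CF('Z(G))).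
Hypotheses (lin_lam : lam \is a linear_char) (sG'Z : G^`(1)%g \subset 'Z(G)).
Hypothesis nondeg : forall g, g \in G ->
  (forall h, h \in G -> lam [~ g, h]%g = 1) -> g \in 'Z(G).

Local Notation Z := 'Z(G).
Local Notation K0 := (cfker lam).
Local Notation form x y := (lam [~ x, y]%g).

Let sZG : Z \subset G := center_sub G.

Lemma comm_center x y : x \in G -> y \in G -> [~ x, y]%g \in Z.
Proof. by move=> Gx Gy; apply: (subsetP sG'Z); apply: mem_commg. Qed.

Lemma center_conj z x : z \in Z -> x \in G -> (z ^ x)%g = z.
Proof.
by case/centerP=> Gz cz Gx; rewrite conjgE (cz x Gx) mulKg.
Qed.

Lemma center_mulC z x : z \in Z -> x \in G -> (x * z = z * x)%g.
Proof. by case/centerP=> Gz cz Gx; rewrite (cz x Gx). Qed.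

Lemma formMl x y z : x \in G -> y \in G -> z \in G ->
  form (x * y)%g z = form x z * form y z.
Proof.
move=> Gx Gy Gz; rewrite commMgJ center_conj ?comm_center //.
by rewrite lin_charM ?comm_center.
Qed.

Lemma formV x y : x \in G -> y \in G -> form y x = (form x y)^-1.
Proof. by move=> Gx Gy; rewrite -invg_comm lin_charV ?comm_center. Qed.

Lemma formMr x y z : x \in G -> y \in G -> z \in G ->
  form x (y * z)%g = form x y * form x z.
Proof.
move=> Gx Gy Gz.
by rewrite formV ?groupM // formMl // invfM -!formV.
Qed.

Lemma formZl z x : z \in Z -> x \in G -> form z x = 1.
Proof.
move=> Zz Gx; rewrite commgEl center_conj // mulVg.
exact: lin_char1.
Qed.

Lemma formXl x y n : x \in G -> y \in G -> form (x ^+ n)%g y = form x y ^+ n.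
Proof.
move=> Gx Gy; elim: n => [|n IH]; first by rewrite formZl ?group1.
by rewrite expgS formMl ?groupX // IH exprS.
Qed.

Lemma form_neq0 x y : x \in G -> y \in G -> form x y != 0.
Proof. by move=> Gx Gy; rewrite lin_char_neq0 ?comm_center. Qed.

Lemma form11 x : form x x = 1.
Proof. by rewrite (_ : [~ x, x]%g = 1%g) ?lin_char1 //; apply/eqP/commgP. Qed.

Lemma ker_center z : (z \in K0) = (z \in Z) && (lam z == 1).
Proof.
apply/idP/andP => [Kz|[Zz /eqP lz]].
  have Zz := subsetP (cfker_sub lam) z Kz.
  by rewrite Zz -(lin_char1 lin_lam) -[z]mulg1 cfkerMl.
have /irrP[j Dj] := lin_char_irr lin_lam.
by rewrite Dj cfkerEirr inE -Dj lz lin_char1.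
Qed.

Definition perp (S : {set gT}) : {set gT} :=
  [set g in G | [forall h in S, form g h == 1]].

Lemma perpP (S : {set gT}) g : reflect
  (g \in G /\ {in S, forall h, form g h = 1}) (g \in perp S).
Proof.
rewrite inE; apply: (iffP andP) => -[Gg gS]; split=> //.
  by move=> h Sh; apply/eqP; apply: (forall_inP gS).
by apply/forall_inP=> h Sh; rewrite gS.
Qed.

Lemma perp_group_set (S : {group gT}) : S \subset G -> group_set (perp S).
Proof.
move=> sSG; apply/group_setP; split=> [|x y /perpP[Gx xS] /perpP[Gy yS]].
  by apply/perpP; split=> // h Sh; rewrite formZl // (subsetP sSG).
apply/perpP; split=> [|h Sh]; first exact: groupM.
have Gh := subsetP sSG h Sh.
by rewrite formMl // xS // yS // mulr1.
Qed.

(** Both sides are the sum of [lam [~ g, h]] over [g] in [G] and [h] in [H], where only the elements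
    orthogonal to the other group contribute. *)
Lemma card_perp (H : {group gT}) : H \subset G ->
  (#|H| * #|perp H| = #|G| * #|H :&: Z|)%N.
Proof.
move=> sHG; apply/eqP; rewrite -(eqr_nat algC) !natrM; apply/eqP.
have sumH : \sum_(g in G) \sum_(h in H) form g h = #|H|%:R * #|perp H|%:R.
  rewrite (bigID (fun g => g \in perp H)) /= [X in _ + X]big1 ?addr0; last first.
    move=> g /andP[Gg]; rewrite inE Gg /= negb_forall_in => /exists_inP[h Hh gh].
    apply: (sum_hom_eq0 (h := h)) gh => // x y /(subsetP sHG) Gx /(subsetP sHG) Gy.
    exact: formMr.
  rewrite (eq_bigl (mem (perp H))) => [|g]; last by rewrite /= inE; case: (g \in G).
  rewrite (eq_bigr (fun=> #|H|%:R)) => [|g /perpP[_ gH]]; last first.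
    by rewrite (eq_bigr (fun=> 1)) ?sumr_const.
  by rewrite sumr_const mulr_natr.
rewrite -sumH exchange_big /= (bigID (fun h => h \in Z)) /=.
rewrite [X in _ + X]big1 ?addr0; last first.
  move=> h /andP[Hh nZh]; have Gh := subsetP sHG h Hh.
  have [g Gg gh] : exists2 g, g \in G & form g h != 1.
    apply/exists_inP; apply: contraR nZh; rewrite negb_exists_in => /forall_inP all1.
    apply: nondeg => // g Gg; rewrite formV //.
    by have := all1 g Gg; rewrite negbK => /eqP->; rewrite invr1.
  by apply: (sum_hom_eq0 (h := g)) gh => // x y Gx Gy; rewrite formMl.
rewrite (eq_bigl (mem (H :&: Z))) => [|h]; last by rewrite /= !inE.
rewrite (eq_bigr (fun=> #|G|%:R)) => [|h /setIP[Hh Zh]]; last first.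
  rewrite (eq_bigr (fun=> 1)) ?sumr_const // => g Gg.
  by rewrite formV ?formZl ?invr1 // (subsetP sHG).
by rewrite sumr_const mulr_natr.
Qed.

(** Such a [K] stands for the extension of [lam] to [Z * K] that is trivial on [K]. All
    extensions of [lam] that take the same values as [lam] have this form, so maximal
    extensions are found by maximizing their kernel [K]. *)
Definition meets_center_in_ker (K : {group gT}) := (K \subset G) && (K :&: Z == K0).

Lemma max_meets_center_in_ker : {K : {group gT} | maxgroup K meets_center_in_ker}.
Proof.
apply: ex_maxgroup; exists K0%G; rewrite /meets_center_in_ker /=.
by rewrite (subset_trans (cfker_sub _)) //; apply/eqP/setIidPl/cfker_sub.
Qed.

Section Maximal.

Variable K : {group gT}.
Hypothesis maxK : maxgroup K meets_center_in_ker.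

Lemma sKG : K \subset G. Proof. by case/maxgroupP: maxK => /andP[]. Qed.
Lemma K_center : K :&: Z = K0. Proof. by case/maxgroupP: maxK => /andP[_ /eqP]. Qed.

Local Notation A := (Z <*> K)%G.
Definition Kperp : {group gT} := Group (perp_group_set sKG).
Local Notation B := Kperp.

Lemma K0_lam k : k \in K -> k \in Z -> lam k = 1.
Proof.
move=> Kk Zk; have : k \in K0 by rewrite -K_center inE Kk.
by rewrite ker_center => /andP[_ /eqP].
Qed.

Lemma ZKE : A = (Z * K)%g :> {set gT}.
Proof.
by apply: cent_joinEr; rewrite centsC (subset_trans (subsetIr G 'C(G))) ?centS ?sKG.
Qed.

Lemma ZKP x : reflect (exists z k, [/\ z \in Z, k \in K & x = (z * k)%g]) (x \in A).
Proof.
rewrite /= ZKE; apply: (iffP mulsgP) => [[z k Zz Kk ->]|[z [k [Zz Kk ->]]]].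
  by exists z, k.
exact: (Imset2spec Zz Kk).
Qed.

Lemma sZ_ZK : Z \subset A. Proof. exact: joing_subl. Qed.
Lemma sK_ZK : K \subset A. Proof. exact: joing_subr. Qed.
Lemma sKperp_G : B \subset G. Proof. by apply/subsetP=> x /perpP[]. Qed.

(** A commutator of elements of [K] is in [K :&: Z], the kernel of [lam]. *)
Lemma sZK_Kperp : A \subset B.
Proof.
rewrite join_subG; apply/andP; split; apply/subsetP=> x Hx; apply/perpP.
  split=> [|k Kk]; first exact: (subsetP sZG).
  by rewrite formZl // (subsetP sKG).
have Gx := subsetP sKG x Hx; split=> // k Kk; have Gk := subsetP sKG k Kk.
by apply: K0_lam; rewrite ?comm_center // groupR.
Qed.

Lemma sZK_G : A \subset G. Proof. exact: subset_trans sZK_Kperp sKperp_G. Qed.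

Lemma card_ZK : (#|A| * #|K0| = #|Z| * #|K|)%N.
Proof. by rewrite /= ZKE mul_cardG setIC K_center. Qed.

Lemma card_Kperp : (#|K| * #|B| = #|G| * #|K0|)%N.
Proof. by rewrite (card_perp sKG) K_center. Qed.

Lemma form_ZK_Kperp x y : x \in A -> y \in B -> form x y = 1.
Proof.
case/ZKP=> z [k [Zz Kk ->]] /perpP[Gy yK].
have Gz := subsetP sZG z Zz; have Gk := subsetP sKG k Kk.
by rewrite formMl // formZl // mul1r formV // yK // invr1.
Qed.

Lemma card_Kperp_ZK : (#|B| * #|A| = #|G| * #|Z|)%N.
Proof.
apply/eqP; rewrite -(eqn_pmul2l (cardG_gt0 K)) mulnA card_Kperp -mulnA.
by rewrite (mulnC #|K0|) card_ZK [X in _ == X]mulnCA (mulnC #|K|).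
Qed.

(** [Z * K] is contained in the orthogonal of [Kperp], and has the same order by two
    applications of [card_perp]. *)
Lemma perp_perp x : x \in G -> (forall y, y \in B -> form x y = 1) -> x \in A.
Proof.
move=> Gx xB; suff -> : A = perp B :> {set gT} by apply/perpP; split=> // y /xB.
apply/eqP; rewrite eqEcard; apply/andP; split.
  apply/subsetP=> a Aa; apply/perpP; split=> [|y By]; first exact: (subsetP sZK_G).
  exact: form_ZK_Kperp.
rewrite -(leq_pmul2l (cardG_gt0 B)) (card_perp sKperp_G) card_Kperp_ZK leq_pmul2l ?cardG_gt0 //.
by rewrite subset_leq_card ?subsetIr.
Qed.

Lemma Kperp_norm x : x \in B -> x \in 'N(K).
Proof.
move=> Bx; have /perpP[Gx xK] := Bx; rewrite inE; apply/subsetP=> _ /imsetP[k Kk ->].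
have Gk := subsetP sKG k Kk; rewrite conjg_mulR groupM //.
have : [~ k, x]%g \in K0 by rewrite ker_center comm_center // formV // xK // invr1 eqxx.
by rewrite -K_center => /setIP[].
Qed.

Lemma Kperp_norm_ZK x : x \in B -> x \in 'N(A).
Proof.
move=> Bx; rewrite inE; apply/subsetP=> _ /imsetP[y /ZKP[z [k [Zz Kk ->]]] ->].
rewrite conjMg (center_conj Zz (subsetP sKperp_G x Bx)) groupM ?(subsetP sZ_ZK z) //.
by rewrite (subsetP sK_ZK) // memJ_norm // Kperp_norm.
Qed.

(** If [x] were outside [Z * K], then [K] and [x] would generate a larger subgroup with the
    same intersection with the centre. *)
Lemma sqr_in_K x : x \in B -> (x ^+ 2)%g \in K -> x \in A.
Proof.
move=> Bx Kx2; apply/idPn=> nAx; have Gx := subsetP sKperp_G x Bx.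
have [/andP[_ _] Kmax] := maxgroupP maxK.
pose H := (K <*> <[x]>)%G.
have HE : H = (K * <[x]>)%g :> {set gT}.
  by rewrite /= norm_joinEr // cycle_subG Kperp_norm.
suff HK : H = K :> {set gT}.
  case/negP: nAx; apply: (subsetP sK_ZK); rewrite -HK.
  by apply: (subsetP (joing_subr _ _)); apply: cycle_id.
apply: Kmax; last exact: joing_subl.
rewrite /meets_center_in_ker join_subG sKG cycle_subG Gx /= eqEsubset; apply/andP; split; last first.
  by rewrite -K_center setSI // joing_subl.
apply/subsetP=> y /setIP[Hy Zy]; rewrite -K_center inE Zy andbT.
move: Hy; rewrite -/H -[_ \in _]/(y \in (H : {set gT})) HE => /mulsgP[k _ Kk /cycleP[i ->] Dy].
have Kxi : ((x ^+ 2) ^+ i./2)%g \in K by apply: groupX.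
move: Dy; rewrite -[i in (x ^+ i)%g]odd_double_half -mul2n expgD expgM.
case: (odd i) => [|->]; last by rewrite expg0 mul1g groupM.
rewrite expg1; set k' := ((_ ^+ _) ^+ _)%g in Kxi *; move=> Dy.
case/negP: nAx; have -> : x = (y * (k^-1 * k'^-1))%g.
  have Gk : (k^-1)%g \in G by rewrite groupV (subsetP sKG).
  by rewrite mulgA -(center_mulC Zy Gk) Dy -!mulgA mulKg mulgV mulg1.
by apply/ZKP; exists y, (k^-1 * k'^-1)%g; split; rewrite // groupM ?groupV.
Qed.

(** [sqr_in_K] applies to [x * w^-1]. *)
Lemma sqr_lam_sqr x z k w : x \in B -> z \in Z -> k \in K -> w \in Z ->
  (x ^+ 2 = z * k)%g -> lam z = lam w ^+ 2 -> x \in A.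
Proof.
move=> Bx Zz Kk Zw Dx2 Dz; have Gx := subsetP sKperp_G x Bx.
have Zw' : (w^-1)%g \in Z by rewrite groupV.
suff : (x * w^-1)%g \in A by rewrite groupMr // (subsetP sZ_ZK).
apply: sqr_in_K; first by rewrite groupM // (subsetP sZK_Kperp) // (subsetP sZ_ZK).
have cxw : commute x w^-1%g by apply: center_mulC.
have Zzw : (z * w^-1 ^+ 2)%g \in Z by rewrite groupM ?groupX.
have -> : ((x * w^-1) ^+ 2 = (z * w^-1 ^+ 2) * k)%g.
  by rewrite expgMn // Dx2 -mulgA (center_mulC (groupX 2 Zw') (subsetP sKG k Kk)) mulgA.
suff : (z * w^-1 ^+ 2)%g \in K0 by rewrite -K_center => /setIP[Kzw _]; apply: groupM.
rewrite ker_center Zzw lin_charM ?groupX // Dz lin_charX // lin_charV // -exprMn.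
by rewrite mulfV ?lin_char_neq0 // expr1n eqxx.
Qed.

Section Extension.

Variables (D : nzRingType) (mu : gT -> D).
Hypothesis muM : {in Z &, {morph mu : x y / (x * y)%g >-> x * y}}.
Hypothesis mu_ker : {in Z, forall z, lam z = 1 -> mu z = 1}.

(** The extension to [Z * K] of a homomorphism [mu] on [Z], trivially on [K]. *)
Definition extend (x : gT) : D :=
  if [pick z in Z | (z^-1 * x)%g \in K] is Some z then mu z else 0.

Lemma extendE z k : z \in Z -> k \in K -> extend (z * k)%g = mu z.
Proof.
move=> Zz Kk; rewrite /extend; case: pickP => [y /andP[Zy Ky]|/(_ z)]; last first.
  by rewrite /= Zz mulKg Kk.
have Zyz : (y^-1 * z)%g \in Z by rewrite groupM ?groupV.
have Kyz : (y^-1 * z)%g \in K by rewrite mulgA groupMr in Ky.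
by rewrite -[z](mulKVg y) muM // (mu_ker Zyz (K0_lam Kyz Zyz)) mulr1.
Qed.

Lemma extend_center z : z \in Z -> extend z = mu z.
Proof. by move=> Zz; rewrite -{1}[z]mulg1 extendE ?group1. Qed.

Lemma extend1 : extend 1%g = 1.
Proof. by rewrite extend_center ?group1 // mu_ker ?group1 ?lin_char1. Qed.

Lemma extendM : {in A &, {morph extend : x y / (x * y)%g >-> x * y}}.
Proof.
move=> x y /ZKP[z [k [Zz Kk ->]]] /ZKP[z' [k' [Zz' Kk' ->]]].
have Gk := subsetP sKG k Kk.
rewrite -mulgA [(k * _)%g]mulgA (center_mulC Zz' Gk) -[(z' * k * k')%g]mulgA [(z * (z' * _))%g]mulgA.
by rewrite (extendE (groupM Zz Zz') (groupM Kk Kk')) (extendE Zz Kk) (extendE Zz' Kk') muM.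
Qed.

Lemma extendJ x y : x \in A -> y \in B -> extend (x ^ y)%g = extend x.
Proof.
move=> /ZKP[z [k [Zz Kk ->]]] By; rewrite conjMg (center_conj Zz (subsetP sKperp_G y By)).
by rewrite !extendE // memJ_norm // Kperp_norm.
Qed.

End Extension.

Lemma index_sqr (H : {group gT}) : H \subset G -> (#|H| ^ 2 = #|G| * #|Z|)%N ->
  (#|G : H| ^ 2 = #|G : Z|)%N.
Proof.
move=> sHG cardH; apply/eqP; rewrite -(@eqn_pmul2l (#|H| ^ 2)) ?expn_gt0 ?cardG_gt0 //.
by rewrite -expnMn Lagrange // cardH -mulnA Lagrange // mulnn.
Qed.

Hypothesis pG : 2.-group G.
Local Notation d := #[lam]%CF.

Lemma last_power_outside y : y \in G -> y \notin A ->
  exists2 n, (y ^+ n)%g \notin A & (y ^+ n ^+ 2)%g \in A.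
Proof.
move=> Gy nAy; have [N DN] := p_natP pG.
have exs : exists s, (y ^+ (2 ^ s))%g \in A.
  by exists N; rewrite -DN expg_cardG // group1.
case: (ex_minnP exs) => -[|s]; first by rewrite expn0 expg1 (negPf nAy).
move=> As min_s; exists (2 ^ s)%N; last by rewrite -expgM -expnSr.
by apply/negP=> /min_s; rewrite ltnn.
Qed.

Lemma lam_exp z : z \in Z -> lam z ^+ d = 1.
Proof. by move=> Zz; have /dvdn_cforderP/(_ z Zz) := dvdnn d. Qed.

Section OrderAtLeast4.

Hypothesis d4 : (4 %| d)%N.

Let zeta_ex : exists2 z, z \in Z & d.-primitive_root (lam z).
Proof. exact: (lin_char_prim_root _ (pgroupS sZG pG)). Qed.

(** If [x ^ 2 = z1 * k1] and [y ^ 2 = z2 * k2], then [lam z1] and [lam z2] are not squares of values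
    of [lam], so their product is one. The central part of [(x * y) ^ 2] also involves
    [lam [~ y, x]], which is 1 or -1, and -1 is a square because 4 divides [d]. *)
Lemma mul_involutions_mod_ZK x y : x \in B -> y \in B -> x \notin A -> y \notin A ->
  (x ^+ 2)%g \in A -> (y ^+ 2)%g \in A -> (x * y)%g \in A.
Proof.
have [z0 Zz0 prim0] := zeta_ex; set zeta := lam z0 in prim0.
have d_gt0 : (0 < d)%N := prim_order_gt0 prim0.
have lamP z : z \in Z -> exists a, lam z = zeta ^+ a.
  by move=> Zz; have [a ->] := prim_rootP prim0 (lam_exp Zz); exists a.
have evenA u z k a : u \in B -> z \in Z -> k \in K -> (u ^+ 2 = z * k)%g ->
    lam z = zeta ^+ a -> ~~ odd a -> u \in A.
  move=> Bu Zz Kk Du Dz ev_a.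
  apply: (sqr_lam_sqr Bu Zz Kk (groupX a./2 Zz0) Du).
  by rewrite Dz lin_charX // -exprM muln2 even_halfK.
move=> Bx By nAx nAy /ZKP[z1 [k1 [Zz1 Kk1 Dx]]] /ZKP[z2 [k2 [Zz2 Kk2 Dy]]].
have [[a Da] [b Db]] := (lamP _ Zz1, lamP _ Zz2).
have odd_a : odd a by apply: contraR nAx; apply: (evenA x z1 k1).
have odd_b : odd b by apply: contraR nAy; apply: (evenA y z2 k2).
have Gx := subsetP sKperp_G x Bx; have Gy := subsetP sKperp_G y By.
have Zc : [~ y, x]%g \in Z by apply: comm_center.
have [c Dc] := lamP _ Zc.
have even_c : ~~ odd c.
  have : zeta ^+ (c * 2) == 1.
    have Ax2 : (x ^+ 2)%g \in A by apply/ZKP; exists z1, k1.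
    by rewrite exprM -Dc formV // exprVn -formXl // (form_ZK_Kperp Ax2 By) invr1.
  rewrite -(prim_order_dvd prim0) => /(dvdn_trans d4).
  by rewrite -[4%N]/(2 * 2)%N dvdn_pmul2r // dvdn2.
apply: (evenA _ (z1 * z2 * [~ y, x])%g (k1 * k2)%g (a + b + c)%N).
- exact: groupM.
- by apply: groupM => //; apply: groupM.
- exact: groupM.
- rewrite expMg_Rmul; [|exact: center_mulC|exact: center_mulC].
  have Gk1 := subsetP sKG k1 Kk1; have Gk2 := subsetP sKG k2 Kk2.
  rewrite Dx Dy binn expg1; move: [~ y, x]%g Zc {Dc} => c' Zc.
  rewrite -!mulgA (center_mulC Zc Gk2) [(k1 * (z2 * _))%g]mulgA.
  by rewrite (center_mulC Zz2 Gk1) -!mulgA [(k1 * (c' * _))%g]mulgA (center_mulC Zc Gk1) !mulgA.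
- have Zz12 := groupM Zz1 Zz2.
  by rewrite (lin_charM lin_lam Zz12 Zc) (lin_charM lin_lam Zz1 Zz2) Da Db Dc !exprD.
by rewrite !oddD odd_a odd_b (negPf even_c).
Qed.

(** An [x] in [Kperp] that is an involution modulo [Z * K] is orthogonal to every [y] in [Kperp]:
    unless [y] is in [Z * K], [mul_involutions_mod_ZK] makes [x] congruent to a power of [y]
    modulo [Z * K]. *)
Lemma Kperp_eq_ZK : B = A :> {set gT}.
Proof.
apply/eqP; rewrite eqEsubset sZK_Kperp andbT; apply/subsetP=> x0 Bx0; apply/idPn=> nAx0.
have [m nAx Ax2] := last_power_outside (subsetP sKperp_G _ Bx0) nAx0.
set x := (x0 ^+ m)%g in nAx Ax2; have Bx : x \in B by apply: groupX.
have Gx := subsetP sKperp_G x Bx; case/negP: (nAx); apply: perp_perp => // y By.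
have Gy := subsetP sKperp_G y By.
have [Ay|nAy] := boolP (y \in A); first by rewrite formV // (form_ZK_Kperp Ay) // invr1.
have [n nAy' Ay2] := last_power_outside Gy nAy.
have Axy := mul_involutions_mod_ZK Bx (groupX n By) nAx nAy' Ax2 Ay2.
have := form_ZK_Kperp Axy By.
by rewrite (formMl Gx (groupX n Gy) Gy) (formXl n Gy Gy) form11 expr1n mulr1.
Qed.

End OrderAtLeast4.

Section Order2.

Hypothesis d2 : d = 2%N.

Lemma lam_sign z : z \in Z -> lam z = 1 \/ lam z = -1.
Proof.
move=> Zz; have := lam_exp Zz; rewrite d2 => /eqP.
by rewrite -subr_eq0 subr_sqr_1 mulf_eq0 subr_eq0 addr_eq0 => /orP[]/eqP->; [left|right].
Qed.

Lemma signC_neq : (-1 : algC) <> 1.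
Proof. by move/eqP; rewrite eq_sym -subr_eq0 opprK (eqr_nat _ 2 0). Qed.

(** The form takes the values 1 and -1, so squares are in its radical. *)
Lemma sqr_center x : x \in G -> (x ^+ 2)%g \in Z.
Proof.
move=> Gx; apply: nondeg => [|h Gh]; first exact: groupX.
by rewrite formXl // -d2 lam_exp // comm_center.
Qed.

Lemma lam_sqr x : x \in B -> x \notin A -> lam (x ^+ 2)%g = -1.
Proof.
move=> Bx nAx; have Gx := subsetP sKperp_G x Bx.
have [lx|//] := lam_sign (sqr_center Gx); case/negP: nAx.
apply: (@sqr_lam_sqr x (x ^+ 2)%g 1%g 1%g); rewrite ?group1 ?sqr_center ?mulg1 //.
by rewrite lx lin_char1 // expr1n.
Qed.

Lemma lam_sqrM x y : x \in G -> y \in G ->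
  lam ((x * y) ^+ 2)%g = lam (x ^+ 2)%g * lam (y ^+ 2)%g * form y x.
Proof.
move=> Gx Gy; have Zc : [~ y, x]%g \in Z by apply: comm_center.
rewrite expMg_Rmul; [|exact: center_mulC|exact: center_mulC].
have [Zx Zy] := (sqr_center Gx, sqr_center Gy); have Zxy := groupM Zx Zy.
by rewrite binn expg1 (lin_charM lin_lam Zxy Zc) (lin_charM lin_lam Zx Zy).
Qed.

Lemma quaternion_generators : B != A :> {set gT} -> exists g h,
  [/\ g \in B, h \in B, lam (g ^+ 2)%g = -1, lam (h ^+ 2)%g = -1 & form g h = -1].
Proof.
rewrite eqEsubset sZK_Kperp andbT => /subsetPn[g Bg nAg]; have Gg := subsetP sKperp_G g Bg.
have [h Bh gh]: exists2 h, h \in B & form g h != 1.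
  apply/exists_inP; apply: contraR nAg; rewrite negb_exists_in => /forall_inP all1.
  by apply: perp_perp => // y /all1; rewrite negbK => /eqP.
have Gh := subsetP sKperp_G h Bh; exists g, h; split=> //; first exact: lam_sqr.
  apply: lam_sqr => //; apply: contra gh => Ah.
  by rewrite formV // (form_ZK_Kperp Ah) // invr1.
by have [gh1|//] := lam_sign (comm_center Gg Gh); rewrite gh1 eqxx in gh.
Qed.

(** Otherwise [lam] would be -1 at the squares of [l], [g] and [l * g], although [l] and [g] are
    orthogonal. *)
Lemma form_quaternion_trivial g h l :
    g \in B -> h \in B -> lam (g ^+ 2)%g = -1 -> form g h = -1 ->
  l \in B -> form l g = 1 -> form l h = 1 -> l \in A.
Proof.
move=> Bg Bh lg gh Bl lg1 lh1.
have [Gg Gh Gl] : [/\ g \in G, h \in G & l \in G] by split; apply: (subsetP sKperp_G).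
apply/idPn=> nAl; have nAlg : (l * g)%g \notin A.
  apply/negP=> /form_ZK_Kperp/(_ Bh); rewrite formMl // lh1 mul1r gh; exact: signC_neq.
have := lam_sqr (groupM Bl Bg) nAlg; rewrite lam_sqrM // (lam_sqr Bl nAl) lg formV // lg1.
by rewrite invr1 mulr1 mulrNN mulr1 => /esym/signC_neq.
Qed.

(** ** The quaternionic case *)

Section Quaternion.

Variables g h : gT.
Hypotheses (Bg : g \in B) (Bh : h \in B).
Hypotheses (lam_g2 : lam (g ^+ 2)%g = -1) (lam_h2 : lam (h ^+ 2)%g = -1) (form_gh : form g h = -1).

Let Gg : g \in G := subsetP sKperp_G g Bg.
Let Gh : h \in G := subsetP sKperp_G h Bh.

Let form_hg : form h g = -1.
Proof. by rewrite formV // form_gh invrN1. Qed.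

Lemma perp_g_group_set : group_set [set x in B | form x g == 1].
Proof.
apply/group_setP; split=> [|x y /setIdP[Bx /eqP xg] /setIdP[By /eqP yg]].
  by apply/setIdP; rewrite group1 formZl ?group1.
have [Gx Gy] := (subsetP sKperp_G x Bx, subsetP sKperp_G y By).
by apply/setIdP; rewrite groupM // formMl // xg yg mulr1.
Qed.
(** The subgroup generated by [Z * K] and [g], on which [lam] extends with values in [Q(i)]. *)
Definition perp_g : {group gT} := Group perp_g_group_set.

Lemma perp_gP x : reflect (x \in B /\ form x g = 1) (x \in perp_g).
Proof. by apply: (iffP setIdP) => -[Bx /eqP]. Qed.

Lemma sZK_perp_g : A \subset perp_g.
Proof.
apply/subsetP=> x Ax; apply/perp_gP; split; first exact: (subsetP sZK_Kperp).
exact: form_ZK_Kperp.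
Qed.

Lemma perp_g_Kperp : perp_g \subset B. Proof. by apply/subsetP=> x /perp_gP[]. Qed.

Lemma card_Kperp_perp_g : #|B| = #|perp_g|.*2.
Proof.
apply: (card_sign_ker (f := fun x => form x g) _ _ Bh form_hg) => [x y Bx By|x Bx] /=.
  by rewrite formMl // (subsetP sKperp_G).
by apply: lam_sign; rewrite comm_center // (subsetP sKperp_G).
Qed.

(** The orthogonal of [h] in [perp_g] is [Z * K], by [form_quaternion_trivial]. *)
Lemma card_perp_g : #|perp_g| = #|A|.*2.
Proof.
have Pg : g \in perp_g by apply/perp_gP; rewrite form11.
have sPG : perp_g \subset G := subset_trans perp_g_Kperp sKperp_G.
rewrite (card_sign_ker (f := fun x => form x h) _ _ Pg form_gh) => [|x y Px Py|x Px] /=.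
- congr _.*2; apply: eq_card => x.
  apply/idP/idP => [|Ax]; last first.
    by apply/setIdP; rewrite (subsetP sZK_perp_g) // (form_ZK_Kperp Ax Bh).
  move/setIdP=> [/perp_gP[Bx xg] /eqP xh].
  exact: (form_quaternion_trivial Bg Bh).
- by rewrite formMl // (subsetP sPG).
by apply: lam_sign; rewrite comm_center // (subsetP sPG).
Qed.

Lemma card_perp_g_sqr : (#|perp_g| ^ 2 = #|G| * #|Z|)%N.
Proof.
by rewrite -card_Kperp_ZK card_Kperp_perp_g card_perp_g -!muln2 -mulnn mulnA mulnAC.
Qed.

Lemma notin_ZK x y : x \in B -> y \in B -> form x y = -1 -> x \notin A.
Proof.
move=> Bx By xy; apply/negP=> Ax; have := form_ZK_Kperp Ax By; rewrite xy; exact: signC_neq.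
Qed.

Definition lam_rat (z : gT) : rat^o := if lam z == 1 then 1 else -1.

Lemma ratr_lam_rat z : z \in Z -> ratr (lam_rat z) = lam z.
Proof.
move=> Zz; rewrite /lam_rat; case: (lam_sign Zz) => ->; first by rewrite eqxx rmorph1.
by case: eqP => [/signC_neq//|_]; rewrite rmorphN1.
Qed.

Lemma lam_ratM : {in Z &, {morph lam_rat : x y / (x * y)%g >-> x * y}}.
Proof.
move=> x y Zx Zy; apply: (fmorph_inj (@ratr algC)).
by rewrite rmorphM /= !ratr_lam_rat ?groupM // lin_charM.
Qed.

Lemma lam_rat_ker : {in Z, forall z, lam z = 1 -> lam_rat z = 1}.
Proof. by move=> z Zz lz; rewrite /lam_rat lz eqxx. Qed.

Local Notation ext := (extend lam_rat).

Definition ext0 (x : gT) : rat := if x \in A then ext x else 0.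

Lemma ext0Ml a x : a \in A -> ext0 (a * x)%g = ext a * ext0 x.
Proof.
move=> Aa; rewrite /ext0 groupMl //; case: ifP => Ax; last by rewrite mulr0.
exact: (extendM lam_ratM lam_rat_ker).
Qed.

Lemma ext0_center z x : z \in Z -> ext0 (z * x)%g = lam_rat z * ext0 x.
Proof. by move=> Zz; rewrite ext0Ml ?(subsetP sZ_ZK) // (extend_center lam_ratM lam_rat_ker). Qed.

Lemma ext0_move q a x : q \in B -> a \in A -> ext0 (q^-1 * (a * x))%g = ext a * ext0 (q^-1 * x)%g.
Proof.
move=> Bq Aa; have -> : (q^-1 * (a * x) = a ^ q * (q^-1 * x))%g.
  by rewrite conjgE -!mulgA mulKVg.
by rewrite ext0Ml ?memJ_norm ?Kperp_norm_ZK // (extendJ lam_ratM lam_rat_ker).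
Qed.

(** An element of [Kperp] is [q * a] with [q] one of 1, [g], [h], [g * h] and [a] in [Z * K]. At such
    an element, all the coordinates vanish but that of [q], which is the value of the
    extension of [lam] at [a]; this avoids a choice of [q]. *)
Definition quat_hom (x : gT) : quat rat :=
  Quat (ext0 x) (ext0 (g^-1 * x)%g) (ext0 (h^-1 * x)%g) (ext0 ((g * h)^-1 * x)%g).

Lemma lam_rat_eq z e : z \in Z -> lam z = ratr e -> lam_rat z = e.
Proof. by move=> Zz le; apply: (fmorph_inj (@ratr algC)); rewrite /= ratr_lam_rat. Qed.

Lemma quat_hom1 : quat_hom 1%g = 1.
Proof.
have E x : x \in B -> x \notin A -> ext0 (x^-1 * 1)%g = 0.
  by move=> Bx nAx; rewrite mulg1 /ext0 groupV (negPf nAx).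
have ngh : (g * h)%g \notin A.
  by apply: (notin_ZK _ Bg); rewrite ?groupM // formMl // form11 mul1r.
have nAh : h \notin A := notin_ZK Bh Bg form_hg.
have nAg : g \notin A := notin_ZK Bg Bh form_gh.
rewrite /quat_hom (E g) // (E h) // (E (g * h)%g (groupM Bg Bh) ngh).
by rewrite /ext0 group1 (extend1 lam_ratM lam_rat_ker).
Qed.

Lemma quat_homM_ZK a x : a \in A -> quat_hom (a * x)%g = ext a *: quat_hom x.
Proof. by move=> Aa; rewrite /quat_hom ext0Ml // !ext0_move ?groupM. Qed.

Lemma quat_homMg x : quat_hom (g * x)%g = Quat 0 1 0 0 * quat_hom x.
Proof.
have Zg2 := sqr_center Gg; have lg : lam_rat (g ^+ 2)%g = -1.
  by apply: lam_rat_eq; rewrite // lam_g2 rmorphN1.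
have E y : ext0 (g ^+ 2 * y)%g = - ext0 y by rewrite ext0_center // lg mulN1r.
have -> : quat_hom (g * x)%g = Quat (- ext0 (g^-1 * x)%g) (ext0 x)
    (- ext0 ((g * h)^-1 * x)%g) (ext0 (h^-1 * x)%g).
  rewrite /quat_hom mulKg -!E; congr Quat.
  - by rewrite !mulgA mulgK.
  - have c2 : (h^-1 * g ^+ 2 = g ^+ 2 * h^-1)%g by apply: center_mulC; rewrite ?groupV.
    have gg : (g ^+ 2 * g^-1 = g)%g := mulgK g g.
    congr ext0; rewrite invMg [RHS]mulgA [(g ^+ 2 * _)%g]mulgA -c2.
    by rewrite -[(h^-1 * _ * g^-1)%g]mulgA gg -mulgA.
  by rewrite invMg -!mulgA mulKg.
rewrite /quat_hom; congr Quat; ring.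
Qed.

Lemma quat_homMh x : quat_hom (h * x)%g = Quat 0 0 1 0 * quat_hom x.
Proof.
have Zh2 := sqr_center Gh; have Zc := comm_center Gg Gh; have Zc' := comm_center Gh Gg.
have E z y : z \in Z -> lam z = -1 -> ext0 (z * y)%g = - ext0 y.
  by move=> Zz lz; rewrite ext0_center // (@lam_rat_eq z (-1)) ?mulN1r // rmorphN1.
have Eh y : ext0 (h ^+ 2 * y)%g = - ext0 y by apply: E.
have -> : quat_hom (h * x)%g = Quat (- ext0 (h^-1 * x)%g) (ext0 ((g * h)^-1 * x)%g)
    (ext0 x) (- ext0 (g^-1 * x)%g).
  have Dgh : (g^-1 * (h * x) = (h ^+ 2 * [~ g, h]) * ((g * h)^-1 * x))%g.
    have c2 : (g^-1 * h ^+ 2 = h ^+ 2 * g^-1)%g by apply: center_mulC; rewrite ?groupV.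
    have hh : (h ^+ 2 * h^-1 = h)%g := mulgK h h.
    have e1 : ([~ g, h] * (g * h)^-1 = g^-1 * h^-1)%g.
      by rewrite commgEl conjgE invMg !mulgA !mulgK.
    rewrite -[RHS]mulgA [([~ g, h] * _)%g]mulgA e1 -[(g^-1 * h^-1 * x)%g]mulgA.
    by rewrite [RHS]mulgA -c2 -[RHS]mulgA [(h ^+ 2 * _)%g]mulgA hh.
  have Dh : ((g * h)^-1 * (h * x) = [~ h, g] * (g^-1 * x))%g.
    by rewrite invMg commgEl conjgE -!mulgA mulKVg.
  rewrite /quat_hom mulKg Dgh Dh; congr Quat.
  - by rewrite -Eh !mulgA mulgK.
  - by rewrite -mulgA Eh E // opprK.
  exact: E.
rewrite /quat_hom; congr Quat; ring.
Qed.

(** The [b] that satisfy the equation for all [x] form a set closed under products, which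
    contains [Z * K], [g] and [h]. *)
Lemma quat_homM : {in B &, {morph quat_hom : x y / (x * y)%g >-> x * y}}.
Proof.
pose good b := b \in B /\ forall x, quat_hom (b * x)%g = quat_hom b * quat_hom x.
have goodM b c : good b -> good c -> good (b * c)%g.
  move=> [Bb gb] [Bc gc]; split=> [|x]; first exact: groupM.
  by rewrite -mulgA (gb (c * x)%g) (gc x) (gb c) mulrA.
have goodA a : a \in A -> good a.
  move=> Aa; split=> [|x]; first exact: (subsetP sZK_Kperp).
  by rewrite quat_homM_ZK // -[in RHS](mulg1 a) quat_homM_ZK // quat_hom1 -scalerAl mul1r.
have goodg : good g.
  by split=> // x; rewrite quat_homMg -[in RHS](mulg1 g) quat_homMg quat_hom1 mulr1.
have goodh : good h.
  by split=> // x; rewrite quat_homMh -[in RHS](mulg1 h) quat_homMh quat_hom1 mulr1.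
have goodgh := goodM _ _ goodg goodh.
suff goodB b : b \in B -> good b by move=> x y Bx By; case: (goodB x Bx).
move=> Bb; have Gb := subsetP sKperp_G b Bb.
have shift q : good q -> form b g = form q g -> form b h = form q h -> good b.
  move=> gq bqg bqh; have [Bq _] := gq; have Gq := subsetP sKperp_G q Bq.
  rewrite -[b](mulKVg q); apply: goodM => //; apply: goodA.
  have Gq' : (q^-1)%g \in G by rewrite groupV.
  have inv y : y \in G -> form q^-1%g y = (form q y)^-1.
    move=> Gy; apply: (mulIf (form_neq0 Gq Gy)); rewrite mulVf ?form_neq0 //.
    by rewrite -formMl // mulVg formZl ?group1.
  apply: (form_quaternion_trivial Bg Bh); rewrite ?groupM ?groupV //.
    by rewrite formMl // inv // bqg mulVf ?form_neq0.
  by rewrite formMl // inv // bqh mulVf ?form_neq0.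
have form_ghg : form (g * h)%g g = -1 by rewrite formMl // form11 mul1r.
have form_ghh : form (g * h)%g h = -1 by rewrite formMl // form11 mulr1.
have [bg|bg] := lam_sign (comm_center Gb Gg); have [bh|bh] := lam_sign (comm_center Gb Gh).
- by apply: (shift 1%g); rewrite ?(formZl (group1 _) Gg) ?(formZl (group1 _) Gh) //; apply: goodA; apply: group1.
- by apply: (shift g); rewrite ?form11 ?form_gh.
- by apply: (shift h); rewrite ?form11 ?form_hg.
by apply: (shift (g * h)%g); rewrite ?form_ghg ?form_ghh.
Qed.

Lemma quat_hom_center z : z \in Z -> quat_hom z = lam_rat z *: 1.
Proof.
move=> Zz; rewrite -[z in quat_hom z]mulg1 quat_homM_ZK ?(subsetP sZ_ZK) // quat_hom1.
by rewrite (extend_center lam_ratM lam_rat_ker).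
Qed.

Lemma quat_hom_perp_g x : x \in perp_g ->
  quat_j (quat_hom x) = 0 /\ quat_k (quat_hom x) = 0.
Proof.
case/perp_gP=> Bx xg; have Gx := subsetP sKperp_G x Bx.
have E q : q \in B -> form q g = -1 -> ext0 (q^-1 * x)%g = 0.
  move=> Bq qg; have Gq := subsetP sKperp_G q Bq.
  rewrite /ext0; case: ifP => // /form_ZK_Kperp/(_ Bg).
  rewrite formMl ?groupV // xg mulr1 => q1; case: signC_neq.
  by rewrite -qg -[LHS]mul1r -q1 -formMl ?groupV // mulVg formZl ?group1.
split; rewrite /= E // ?groupM // formMl // form11 mul1r //.
Qed.

End Quaternion.

End Order2.

End Maximal.

End Pairing.

(** * From algebra morphisms to the decomposition of the group algebra *)

(** Only upper bounds on dimensions are recorded: in the end, their sum is compared with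
    the order of the group. *)
Definition embeds (A : lmodType rat) (m : nat) :=
  exists e : A -> 'rV[rat]_m, linear e /\ injective e.

Section Blocks.

Variables (gT : finGroupType) (G : {group gT}).
Local Notation QG := (galg rat (subg_of G)).

(** [u] is in the kernel of the representations affording [i], as seen by traces. *)
Definition annihilates (u : QG) (i : Iirr G) :=
  forall y, y \in G -> \sum_x ratr (u x) * 'chi_i (sgval x * y)%g = 0.

Definition weight (S : {set Iirr G}) : algC := \sum_(i in S) 'chi_i 1%g ^+ 2.

(** A candidate [A] for the product of the simple factors of [QG] that belong to the characters
    in [S]. *)
Definition block (A : algType rat) (S : {set Iirr G}) :=
  exists m, [/\ embeds A m, m%:R <= weight S &
    exists f : QG -> A, [/\ linear f, monoid_morphism f &
      forall u, f u = 0 -> {in S, forall i, annihilates u i}]].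

Lemma sum_chi1_mul x : \sum_i 'chi[G]_i 1%g * 'chi_i x = cfReg G x.
Proof. by rewrite cfReg_sum sum_cfunE; apply: eq_bigr => i _; rewrite cfunE. Qed.

(** The regular character, a combination of all the irreducible ones, reads off the
    coefficients of [u]. *)
Lemma annihilates_all u : (forall i, annihilates u i) -> u = 0.
Proof.
move=> ann; apply/ffunP=> x; rewrite ffunE; apply: (fmorph_inj (@ratr algC)).
have: \sum_i 'chi[G]_i 1%g * \sum_z ratr (u z) * 'chi_i (sgval z * (sgval x)^-1)%g = 0.
  by rewrite big1 // => i _; rewrite (ann i) ?mulr0 // groupV subgP.
under eq_bigr do rewrite mulr_sumr.
rewrite exchange_big /=.
under eq_bigr => z _.
  under eq_bigr do rewrite mulrCA.
  rewrite -mulr_sumr.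
  rewrite sum_chi1_mul cfRegE -eq_mulgV1 (inj_eq val_inj).
  over.
rewrite (bigD1 x) //= eqxx big1 ?addr0 => [|z /negPf->]; last by rewrite mulr0.
move/eqP; rewrite mulf_eq0 (negPf (neq0CG G)) orbF => /eqP->.
by rewrite rmorph0.
Qed.

Lemma annihilates_aut (s : {rmorphism algC -> algC}) u i :
  annihilates u i -> annihilates u (aut_Iirr s i).
Proof.
move=> ann y Gy; have := congr1 s (ann y Gy); rewrite rmorph0 rmorph_sum; apply: etrans.
apply: eq_bigr => x _.
by rewrite rmorphM aut_IirrE cfunE fmorph_rat.
Qed.

Section BlockOfRepresentation.

Variables (A : algType rat) (rho : gT -> A).
Hypotheses (rho1 : rho 1%g = 1) (rhoM : {in G &, {morph rho : x y / (x * y)%g >-> x * y}}).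

Definition galg_lift (u : QG) : A := \sum_x u x *: rho (sgval x).

Lemma galg_lift_linear : linear galg_lift.
Proof.
move=> c u v; rewrite /galg_lift scaler_sumr -big_split /=; apply: eq_bigr => x _.
by rewrite !ffunE scalerDl scalerA.
Qed.

Lemma galg_lift_monoid : monoid_morphism galg_lift.
Proof.
split=> [|u v].
  rewrite /galg_lift (bigD1 1%g) //= ffunE eqxx scale1r rho1 big1 ?addr0 // => x /negPf nx1.
  by rewrite ffunE nx1 scale0r.
rewrite /galg_lift mulr_suml.
under eq_bigr do rewrite ffunE scaler_suml.
rewrite exchange_big /=; apply: eq_bigr => y _; rewrite mulr_sumr.
rewrite (reindex_inj (mulgI y)) /=; apply: eq_bigr => x _.
rewrite mulKg -scalerAl -scalerAr scalerA rhoM ?subgP //.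
Qed.

(** The form [t] recovers [i] from [rho], so an element in the kernel of the extension of [rho] to
    [QG] annihilates [i]. It also annihilates the Galois conjugates of [i], because its
    coefficients are rational. *)
Lemma block_of_repr (t : A -> algC) (m : nat) (i : Iirr G) (S : {set Iirr G}) :
    {morph t : a b / a + b} -> (forall c a, t (c *: a) = ratr c * t a) ->
    {in G, forall x, t (rho x) = 'chi_i x} ->
    {in S, forall j, exists s, j = aut_Iirr s i} ->
    embeds A m -> m%:R <= weight S ->
  block A S.
Proof.
move=> tD tZ t_rho conjS em le_m; exists m; split=> //.
have [lift1 liftM] := galg_lift_monoid.
exists galg_lift; split=> [||u fu0 j Sj]; first exact: galg_lift_linear.
  by split.
have [s ->] := conjS j Sj; apply: annihilates_aut => y Gy.
have t0 : t 0 = 0 by rewrite -[0](scale0r (0 : A)) tZ rmorph0 mul0r.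
transitivity (t (galg_lift u * rho y)); last by rewrite fu0 mul0r.
rewrite /galg_lift mulr_suml (big_morph t tD t0); apply: eq_bigr => x _.
by rewrite -scalerAl tZ -rhoM ?subgP // t_rho // groupM ?subgP.
Qed.

End BlockOfRepresentation.

Inductive realizes : seq (algType rat) -> {set Iirr G} -> Prop :=
| realizes_nil : realizes [::] set0
| realizes_cons A s (S T : {set Iirr G}) : block A S -> [disjoint S & T] -> realizes s T ->
    realizes (A :: s) (S :|: T).

Lemma weightU (S T : {set Iirr G}) : [disjoint S & T] ->
  weight (S :|: T) = weight S + weight T.
Proof.
move=> dST; rewrite /weight -bigU //; apply: eq_bigl => i.
by rewrite !inE.
Qed.

Lemma realizes_cat s1 s2 (T1 T2 : {set Iirr G}) : realizes s1 T1 -> realizes s2 T2 ->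
  [disjoint T1 & T2] -> realizes (s1 ++ s2) (T1 :|: T2).
Proof.
move=> r1 r2; elim: r1 => [|A s S T bA dST _ IH] /=; first by rewrite set0U.
rewrite -!setI_eq0 setIUl setU_eq0 !setI_eq0 => /andP[dS2 dT2].
rewrite -setUA; apply: realizes_cons => //; last exact: IH.
by rewrite -setI_eq0 setIUr setU_eq0 !setI_eq0 dST.
Qed.

Lemma realizes_nth s T (A0 : algType rat) : realizes s T -> exists S : nat -> {set Iirr G},
  [/\ forall k, (k < size s)%N -> block (nth A0 s k) (S k),
      {in T, forall i, exists2 k, (k < size s)%N & i \in S k}
    & \sum_(k < size s) weight (S k) = weight T].
Proof.
elim=> [|A {}s S {}T bA dST _ [Sk [bS coverS wS]]].
  by exists (fun=> set0); split=> // [i|]; rewrite ?inE // big_ord0 /weight big_set0.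
exists (fun k => if k is k'.+1 then Sk k' else S); split=> [[|k] //||].
- by rewrite /= ltnS; apply: bS.
- move=> i; rewrite inE => /orP[Si|/coverS[k ltk Ski]]; first by exists 0%N.
  by exists k.+1.
by rewrite big_ord_recl /= wS weightU.
Qed.

Lemma realizes_flatten (I : eqType) (r : seq I) (o : Iirr G -> I)
    (F : I -> seq (algType rat)) (X : {set Iirr G}) :
  uniq r -> {in r, forall d, realizes (F d) [set i in X | o i == d]} ->
  realizes (flatten [seq F d | d <- r]) [set i in X | o i \in r].
Proof.
elim: r => [|d r IH] /=.
  rewrite (_ : [set i in X | _] = set0) => [*|]; first exact: realizes_nil.
  by apply/setP=> i; rewrite !inE andbF.
case/andP=> nrd Ur HF.
rewrite (_ : [set i in X | _] = [set i in X | o i == d] :|: [set i in X | o i \in r]).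
  apply: realizes_cat; first by apply: HF; rewrite mem_head.
    by apply: IH => // e re; apply: HF; rewrite inE re orbT.
  rewrite -setI_eq0; apply/eqP/setP=> i; rewrite !inE.
  by case: eqP => [->|]; rewrite ?(negPf nrd) ?andbF.
by apply/setP=> i; rewrite !inE andb_orr.
Qed.

(** The joint morphism is injective by [annihilates_all]. The dimension of the direct sum is at
    most the sum of the squares of all the degrees, which is the order of [G]. *)
Lemma isomorphic_of_realizes s : realizes s setT -> isomorphic_to_dsum QG s.
Proof.
move=> /(@realizes_nth _ _ (rat^o : algType rat))[S [bS coverS wS]].
pose Ai (i : 'I_(size s)) := nth (rat^o : algType rat) s i.
have data (i : 'I_(size s)) : exists p : {m : nat & ((Ai i -> 'rV[rat]_m) * (QG -> Ai i))%type},
   [/\ linear (tagged p).1 /\ injective (tagged p).1, (tag p)%:R <= weight (S i),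
      linear (tagged p).2 /\ monoid_morphism (tagged p).2 &
      forall u, (tagged p).2 u = 0 -> {in S i, forall j, annihilates u j}].
  have [m [[e [elin einj]] le_m [f [flin fmon fker]]]] := bS i (ltn_ord i).
  by exists (existT (fun m => ((Ai i -> 'rV[rat]_m) * (QG -> Ai i))%type) m (e, f)).
pose p i := sval (cid (data i)); have pP i := svalP (cid (data i)).
pose m i := tag (p i); pose e i : Ai i -> 'rV[rat]_(m i) := (tagged (p i)).1.
pose f i : QG -> Ai i := (tagged (p i)).2.
have elin i : linear (e i) by case: (pP i) => [[]].
have einj i : injective (e i) by case: (pP i) => [[]].
have flin i : linear (f i) by case: (pP i) => _ _ [].
have fmon i : monoid_morphism (f i) by case: (pP i) => _ _ [].
have fker i u : f i u = 0 -> {in S i, forall j, annihilates u j} by case: (pP i) => _ _ _; apply.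
have le_m i : (m i)%:R <= weight (S i) by case: (pP i).
pose J := {i : 'I_(size s) & 'I_(m i)}.
pose phi (u : QG) : dsum s := [ffun i => f i u].
have phi_lin : linear phi by move=> c u v; apply/ffunP=> i; rewrite !ffunE flin.
have phi_inj u : phi u = 0 -> u = 0.
  move=> /ffunP phi0; apply: annihilates_all => j.
  have [k ltk Skj] := coverS j (in_setT j).
  by apply: (fker (Ordinal ltk)) => //; have := phi0 (Ordinal ltk); rewrite !ffunE.
exists phi; split=> //.
  by split=> [|u v]; apply/ffunP=> i; rewrite !ffunE; case: (fmon i) => f1 fM; [apply: f1|apply: fM].
have leJ : (#|{: J}| <= #|subg_of G|)%N.
  rewrite -(ler_nat algC) card_tagged sumnE big_map big_enum /=.
  under eq_bigr do rewrite card_ord.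
  rewrite natr_sum (le_trans (ler_sum _ (fun i _ => le_m i))) // wS.
  rewrite /weight (eq_bigl predT) => [|i]; last by rewrite inE.
  by rewrite irr_sum_square (card_isog (isog_subg G)) cardsT.
pose E (y : dsum s) : 'rV[rat]_#|{: J}| :=
  \row_j e (tag (enum_val j)) (y (tag (enum_val j))) 0 (tagged (enum_val j)).
have Elin : linear E.
  by move=> c y z; apply/rowP=> j; rewrite !mxE !ffunE elin !mxE.
have Einj : injective E.
  move=> y z /rowP eqE; apply/ffunP=> i; apply: einj; apply/rowP=> j.
  by have := eqE (enum_rank (Tagged (fun i => 'I_(m i)) j : J)); rewrite !mxE enum_rankK.
pose R (v : 'rV[rat]_#|subg_of G|) : QG := [ffun x => v 0 (enum_rank x)].
have Rlin : linear R by move=> c y z; apply/ffunP=> x; rewrite !ffunE !mxE.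
have Rinj v : R v = 0 -> v = 0.
  by move=> /ffunP R0; apply/rowP=> j; have := R0 (enum_val j); rewrite !ffunE enum_valK mxE.
pose h v := E (phi (R v)).
have hlin : linear h by move=> c y z; rewrite /h Rlin phi_lin Elin.
pose hL : {linear _ -> _} := HB.pack h (GRing.isLinear.Build _ _ _ _ h hlin).
have freeH : row_free (lin1_mx hL).
  apply: inj_row_free => v; rewrite mul_rV_lin1 => hv0; apply/Rinj/phi_inj/Einj.
  have E0 : E 0 = 0 by have := Elin (-1) 0 0; rewrite scaler0 addr0 scaleN1r addNr.
  by rewrite E0 -[LHS]/(h v).
have fullH : row_full (lin1_mx hL).
  rewrite /row_full eqn_leq rank_leq_col /= (leq_trans leJ) //.
  by move: freeH; rewrite /row_free => /eqP->.
have phi_injective : injective phi.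
  move=> u v eq_uv; apply/eqP; rewrite -subr_eq0; apply/eqP/phi_inj.
  have -> : u - v = -1 *: v + u by rewrite scaleN1r addrC.
  by rewrite phi_lin eq_uv scaleN1r addNr.
have surj y : exists u, phi u == y.
  have /submxP[v Dv] := submx_full (E y) fullH; exists (R v).
  by apply/eqP/Einj; rewrite Dv mul_rV_lin1.
exists (fun y => xchoose (surj y)) => [u|y]; last exact/eqP/(xchooseP (surj y)).
by apply: phi_injective; apply/eqP/(xchooseP (surj (phi u))).
Qed.

End Blocks.

(** * Galois orbits of characters *)

(** The default [idfun] is taken when [k] is not coprime to [d]. *)
Definition galaut (d k : nat) : {rmorphism algC -> algC} :=
  if insub k is Some co_kd then sval (Qn_aut_exists (valP (co_kd : {k | coprime k d})))
  else idfun.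

Lemma galautE d k z : coprime k d -> z ^+ d = 1 -> galaut d k z = z ^+ k.
Proof.
move=> co_kd; rewrite /galaut insubT.
exact: (svalP (Qn_aut_exists (valP (Sub k co_kd : {k | coprime k d})))).
Qed.

Lemma card_coprime_ord d : #|[pred k : 'I_d | coprime k d]| = totient d.
Proof.
rewrite totient_count_coprime big_mkord -sum1_card [LHS]big_mkcond /=.
by apply: eq_bigr => k _; rewrite inE coprime_sym; case: coprime.
Qed.

Section GaloisOrbits.

Variables (gT : finGroupType) (G : {group gT}) (d : nat).
Hypothesis d_gt0 : (0 < d)%N.

(** The Galois group of [Q(zeta_d)] acts on such a character as it acts on the [d]-th roots of
    unity. *)
Definition cyclotomic_type (i : Iirr G) :=
  {in G, forall x, exists c : nat, exists2 w, w ^+ d = 1 & 'chi_i x = c%:R * w}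
  /\ exists2 z, z \in G & exists2 w, d.-primitive_root w & 'chi_i z = 'chi_i 1%g * w.

Definition gal_orbit (i : Iirr G) : {set Iirr G} :=
  [set aut_Iirr (galaut d (val k)) i | k in [pred k : 'I_d | coprime k d]].

Lemma aut_chi1 (s : {rmorphism algC -> algC}) (i : Iirr G) :
  'chi_(aut_Iirr s i) 1%g = 'chi_i 1%g.
Proof. by rewrite aut_IirrE cfunE irr1_degree rmorph_nat. Qed.

Lemma galaut_value (i : Iirr G) x c w k : coprime k d -> w ^+ d = 1 ->
  'chi_i x = c%:R * w -> 'chi_(aut_Iirr (galaut d k) i) x = c%:R * w ^+ k.
Proof.
by move=> co_kd wd Dx; rewrite aut_IirrE cfunE Dx rmorphM rmorph_nat galautE.
Qed.

Lemma galaut_value1 (i : Iirr G) z w k : coprime k d -> w ^+ d = 1 ->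
  'chi_i z = 'chi_i 1%g * w -> 'chi_(aut_Iirr (galaut d k) i) z = 'chi_i 1%g * w ^+ k.
Proof. by rewrite irr1_degree; apply: galaut_value. Qed.

Lemma cyclotomic_type_aut i k : coprime k d ->
  cyclotomic_type i -> cyclotomic_type (aut_Iirr (galaut d k) i).
Proof.
move=> co_kd [val_i [z Gz [w prim_w Dz]]]; split=> [x Gx|].
  have [c [w' wd Dx]] := val_i x Gx; exists c, (w' ^+ k); last exact: galaut_value.
  by rewrite exprAC wd expr1n.
exists z => //; exists (w ^+ k); first by rewrite prim_root_exp_coprime.
by rewrite aut_chi1 (galaut_value1 _ _ Dz) // (prim_expr_order prim_w).
Qed.

(** Distinct [k] give distinct powers of a primitive root. *)
Lemma card_gal_orbit i : cyclotomic_type i -> #|gal_orbit i| = totient d.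
Proof.
case=> _ [z Gz [w prim_w Dz]]; rewrite card_in_imset ?card_coprime_ord //.
move=> k l; rewrite !inE => co_k co_l eq_kl; apply/val_inj/eqP => /=.
have wd := prim_expr_order prim_w.
have : w ^+ k == w ^+ l.
  apply/eqP/(mulfI (irr1_neq0 i)).
  by rewrite -(galaut_value1 co_k wd Dz) -(galaut_value1 co_l wd Dz) eq_kl.
by rewrite (eq_prim_root_expr prim_w) !modn_small.
Qed.

Lemma mem_gal_orbit k i : coprime k d -> cyclotomic_type i ->
  aut_Iirr (galaut d k) i \in gal_orbit i.
Proof.
move=> co_kd [val_i _]; apply/imsetP; exists (Ordinal (ltn_pmod k d_gt0)).
  by rewrite inE /= coprime_modl.
apply/irr_inj/cfun_inP=> x Gx; have [c [w wd Dx]] := val_i x Gx.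
by rewrite !(galaut_value _ wd Dx) //= ?coprime_modl // expr_mod.
Qed.

Lemma gal_orbit_refl i : cyclotomic_type i -> i \in gal_orbit i.
Proof.
move=> ti; have := @mem_gal_orbit 1 i (coprime1n d) ti.
suff -> : aut_Iirr (galaut d 1) i = i by [].
case: ti => val_i _; apply/irr_inj/cfun_inP=> x Gx; have [c [w wd Dx]] := val_i x Gx.
by rewrite (galaut_value _ wd Dx) ?coprime1n // expr1 -Dx.
Qed.

Lemma gal_orbit_type i j : cyclotomic_type i -> j \in gal_orbit i -> cyclotomic_type j.
Proof. by move=> ti /imsetP[k]; rewrite inE => co_k ->; apply: cyclotomic_type_aut. Qed.

(** One inclusion is transitivity, and both sides have [totient d] elements. *)
Lemma gal_orbit_eq i j : cyclotomic_type i -> j \in gal_orbit i -> gal_orbit j = gal_orbit i.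
Proof.
move=> ti Hj; have tj := gal_orbit_type ti Hj.
apply/eqP; rewrite eqEcard !card_gal_orbit // leqnn andbT.
apply/subsetP=> y /imsetP[l]; rewrite inE => co_l ->.
have /imsetP[k] := Hj; rewrite inE => co_k ->.
have co_kl : coprime (k * l) d by rewrite coprimeMl co_k.
have := mem_gal_orbit co_kl ti.
suff -> : aut_Iirr (galaut d (k * l)) i = aut_Iirr (galaut d l) (aut_Iirr (galaut d k) i) by [].
case: ti => val_i _; apply/irr_inj/cfun_inP=> x Gx; have [c [w wd Dx]] := val_i x Gx.
have wkd : (w ^+ k) ^+ d = 1 by rewrite exprAC wd expr1n.
by rewrite (galaut_value co_kl wd Dx) (galaut_value co_l wkd (galaut_value co_k wd Dx)) exprM.
Qed.

Lemma weight_gal_orbit i : cyclotomic_type i ->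
  weight (gal_orbit i) = (totient d)%:R * 'chi_i 1%g ^+ 2.
Proof.
move=> ti; rewrite -(card_gal_orbit ti) mulr_natl -sumr_const.
by apply: eq_bigr => j /imsetP[k _ ->]; rewrite aut_chi1.
Qed.

Lemma block_gal_orbit (A : algType rat) (rho : gT -> A) (t : A -> algC) (m n : nat) (i : Iirr G) :
    rho 1%g = 1 -> {in G &, {morph rho : x y / (x * y)%g >-> x * y}} ->
    {morph t : a b / a + b} -> (forall c a, t (c *: a) = ratr c * t a) ->
    {in G, forall x, t (rho x) = 'chi_i x} ->
    'chi_i 1%g = n%:R -> cyclotomic_type i ->
    embeds A m -> (m <= totient d * n ^ 2)%N ->
  block A (gal_orbit i).
Proof.
move=> rho1 rhoM tD tZ t_rho Dn ti em le_m.
apply: (block_of_repr rho1 rhoM tD tZ t_rho _ em).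
  by move=> j /imsetP[k _ ->]; eexists.
by rewrite weight_gal_orbit // Dn -natrX -natrM ler_nat.
Qed.

(** [T] is the disjoint union of [a] orbits. *)
Lemma realizes_copies (a : nat) (A : algType rat) (T : {set Iirr G}) :
    {in T, forall i, [/\ cyclotomic_type i, gal_orbit i \subset T & block A (gal_orbit i)]} ->
    #|T| = (totient d * a)%N ->
  realizes (copies a A) T.
Proof.
elim: a T => [|a IH] T HT cardT.
  suff -> : T = set0 by apply: realizes_nil.
  by apply/eqP; rewrite -cards_eq0 cardT muln0.
have [i Ti] : exists i, i \in T.
  by apply/card_gt0P; rewrite cardT muln_gt0 totient_gt0 d_gt0.
have [ti sT bi] := HT i Ti.
have -> : T = gal_orbit i :|: (T :\: gal_orbit i) by rewrite setDE setUIr setUCr setIT (setUidPr sT).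
apply: realizes_cons => //.
  rewrite -setI_eq0; apply/eqP/setP=> j; rewrite in_setI in_setD in_set0.
  by case: (j \in gal_orbit i).
apply: IH; last by rewrite cardsD (setIidPr sT) cardT card_gal_orbit // mulnS addKn.
move=> j; rewrite inE => /andP[nij Tj]; have [tj sjT bj] := HT j Tj; split=> //.
apply/subsetP=> l jl; rewrite inE (subsetP sjT) // andbT; apply: contra nij => il.
by rewrite -(gal_orbit_eq ti il) (gal_orbit_eq tj jl) gal_orbit_refl.
Qed.

End GaloisOrbits.

(** * Dimensions of the simple factors *)

Lemma embeds_rat : embeds (rat^o : algType rat) 1.
Proof.
exists (fun x => x%:M); split=> [c x y|x y /matrixP/(_ 0 0)]; last by rewrite !mxE.
by apply/matrixP=> i j; rewrite !mxE mulrnDl scalerMnr.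
Qed.

Lemma embeds_quat : embeds (quat rat : algType rat) 4.
Proof.
pose coords (q : quat rat) := [tuple quat_re q; quat_i q; quat_j q; quat_k q].
exists (fun q => \row_i tnth (coords q) i); split.
  move=> c [a1 b1 c1 d1] [a2 b2 c2 d2]; apply/rowP=> i; rewrite !mxE.
  by case: i => [[|[|[|[|]]]]] lti.
move=> [a1 b1 c1 d1] [a2 b2 c2 d2] /rowP eq12.
have := (eq12 0, eq12 1, eq12 2%:R, eq12 3%:R); rewrite !mxE !(tnth_nth 0) /=.
by case=> [[[-> ->] ->] ->].
Qed.

Lemma embeds_mx (n : nat) (A : algType rat) (m : nat) :
  (0 < n)%N -> embeds A m -> embeds (mxalg n A : algType rat) (n ^ 2 * m).
Proof.
move=> n_gt0 [e [elin einj]].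
pose J := ('I_n.-1.+1 * 'I_n.-1.+1 * 'I_m)%type.
have -> : (n ^ 2 * m = #|{: J}|)%N by rewrite !card_prod !card_ord prednK.
exists (fun M : mxalg n A => \row_k e (M (enum_val k).1.1 (enum_val k).1.2) 0 (enum_val k).2).
split=> [c M N|M N /rowP eqMN].
  by apply/rowP=> k; rewrite !mxE elin !mxE.
apply/matrixP=> i j; apply: einj; apply/rowP=> k.
by have := eqMN (enum_rank ((i, j), k)); rewrite !mxE enum_rankK.
Qed.

Section Qzeta.

Variable d : nat.
Hypothesis d_gt0 : (0 < d)%N.

Lemma Qzeta_embedding : inhabited {rmorphism Qzeta d -> algC}.
Proof. by rewrite /Qzeta; case: num_field_exists => Q [QC s] /=; constructor. Qed.

Lemma dim_Qzeta_leq : (\dim {:Qzeta d} <= totient d)%N.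
Proof.
have [iota] := Qzeta_embedding; have [z prim_z <-] := QzetaP d_gt0.
rewrite dim_Fadjoin dimv1 muln1 -ltnS -size_minPoly.
pose p : {poly Qzeta d} := map_poly intr 'Phi_d.
have size_p : size p = (totient d).+1.
  by rewrite size_map_poly_id0 ?size_Cyclotomic // (monicP (Cyclotomic_monic d)) oner_eq0.
rewrite -size_p; apply: dvdp_leq; first by rewrite -size_poly_eq0 size_p.
apply: minPoly_dvdp.
  by apply/polyOverP=> i; rewrite coef_map /= rpred_int.
rewrite -(fmorph_root iota) -map_poly_comp /=.
rewrite (eq_map_poly (g := intr)) => [|x]; last by rewrite /= rmorph_int.
rewrite -/(map_poly _ _) [map_poly _ _](Cintr_Cyclotomic (z := iota z)) ?fmorph_primitive_root //.
by rewrite root_cyclotomic ?fmorph_primitive_root.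
Qed.

Lemma embeds_Qzeta : exists2 m, embeds (Qzeta d : algType rat) m & (m <= totient d)%N.
Proof.
exists (\dim {:Qzeta d}); last exact: dim_Qzeta_leq.
exists (fun x => \row_i coord (vbasis {:Qzeta d}) i x); split=> [c x y|x y /rowP eq_xy].
  by apply/rowP=> i; rewrite !mxE linearP.
rewrite (coord_vbasis (memvf x)) (coord_vbasis (memvf y)); apply: eq_bigr => i _.
by have := eq_xy i; rewrite !mxE => ->.
Qed.

Lemma Qzeta_root (iota : {rmorphism Qzeta d -> algC}) w :
  w ^+ d = 1 -> exists x, iota x = w.
Proof.
have [z prim_z _] := QzetaP d_gt0; rewrite -(fmorph_primitive_root iota) in prim_z.
by case/(prim_rootP prim_z) => a ->; exists (z ^+ a); rewrite rmorphXn.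
Qed.

End Qzeta.

(** * Representations induced from homomorphisms to a ring *)

Section Induced.

Variables (gT : finGroupType) (G B : {group gT}) (D : nzRingType) (mu : gT -> D).
Hypotheses (sBG : B \subset G) (mu1 : mu 1%g = 1).
Hypothesis muM : {in B &, {morph mu : x y / (x * y)%g >-> x * y}}.

Local Notation m := #|G : B|%g.

(** [m.-1.+1] is [m], in a form that makes the matrices of this size a ring. *)
Definition coset_repr (i : 'I_m.-1.+1) : gT := repr (nth set0 (enum (rcosets B G)) i).
Local Notation r := coset_repr.

Lemma size_coset_enum : size (enum (rcosets B G)) = m.-1.+1.
Proof. by rewrite -cardE prednK // indexg_gt0. Qed.

Lemma coset_reprE i : nth set0 (enum (rcosets B G)) (val i) = (B :* r i)%g /\ r i \in G.
Proof.
have : nth set0 (enum (rcosets B G)) (val i) \in rcosets B G.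
  by rewrite -mem_enum mem_nth // size_coset_enum ltn_ord.
rewrite /coset_repr => /rcosetsP[x Gx ->].
split; first by rewrite rcoset_repr.
have /rcosetP[b Bb ->] : repr (B :* x)%g \in (B :* x)%g := mem_repr_rcoset B x.
by rewrite groupM // (subsetP sBG).
Qed.

Lemma coset_repr_in i : r i \in G. Proof. by case: (coset_reprE i). Qed.

Lemma coset_repr_ex g : g \in G -> exists i, (g * (r i)^-1)%g \in B.
Proof.
move=> Gg; have BgG : (B :* g)%g \in enum (rcosets B G).
  by rewrite mem_enum; apply/rcosetsP; exists g.
have lti : (index (B :* g)%g (enum (rcosets B G)) < m.-1.+1)%N.
  by rewrite -size_coset_enum index_mem.
exists (Ordinal lti); have [] := coset_reprE (Ordinal lti).
by rewrite /= nth_index // -mem_rcoset => <- _; apply: rcoset_refl.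
Qed.

Lemma coset_repr_inj i j : (r i * (r j)^-1)%g \in B -> i = j.
Proof.
rewrite -mem_rcoset => /rcoset_eqP eq_ij; apply/val_inj/eqP.
rewrite -(nth_uniq set0 _ _ (enum_uniq (rcosets B G))) ?size_coset_enum ?ltn_ord //.
by have [[-> _] [-> _]] := (coset_reprE i, coset_reprE j); rewrite eq_ij.
Qed.

Definition mu_ext0 (x : gT) : D := if x \in B then mu x else 0.

(** The representation induced from [mu], by monomial matrices over a ring [D] that need not be
    commutative. *)
Definition ind_mx (g : gT) : 'M[D]_m.-1.+1 :=
  \matrix_(i, j) mu_ext0 (r i * g * (r j)^-1)%g.

Lemma ind_mx_scalar z : z \in 'Z(G) -> z \in B -> ind_mx z = (mu z)%:M.
Proof.
move=> Zz Bz; have /centerP[Gz cz] := Zz.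
apply/matrixP=> i j; rewrite !mxE -(cz _ (coset_repr_in i)) -mulgA /mu_ext0 groupMl //.
have [<-|nij] := eqVneq i j; first by rewrite mulgV mulg1 group1 mulr1n.
case: ifP => // /coset_repr_inj eq_ij.
by rewrite eq_ij eqxx in nij.
Qed.

Lemma ind_mx1 : ind_mx 1%g = 1.
Proof. by rewrite ind_mx_scalar ?group1 // mu1. Qed.

Lemma mu_ext0Ml x y : x \in B -> mu_ext0 (x * y)%g = mu x * mu_ext0 y.
Proof. by move=> Bx; rewrite /mu_ext0 groupMl //; case: ifP => By; rewrite ?muM ?mulr0. Qed.

Lemma ind_mxM : {in G &, {morph ind_mx : x y / (x * y)%g >-> x * y}}.
Proof.
move=> x y Gx Gy; apply/matrixP=> i j; rewrite !mxE.
have Gi := coset_repr_in i; have Gj := coset_repr_in j.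
have [k Bk] := coset_repr_ex (groupM Gi Gx).
rewrite (bigD1 k) //= big1 ?addr0 => [|l nlk].
  have E : mu_ext0 (r i * x * (r k)^-1)%g = mu (r i * x * (r k)^-1)%g by rewrite /mu_ext0 Bk.
  by rewrite !mxE E -mu_ext0Ml // !mulgA mulgKV.
rewrite !mxE {1}/mu_ext0; case: ifP => [Bl|]; last by rewrite mul0r.
case/eqP: nlk; apply: coset_repr_inj.
by have := groupM (groupVr Bl) Bk; rewrite invMg invgK mulgA mulgKV.
Qed.

Section Trace.

Variable tau : D -> algC.
Hypotheses (tauD : {morph tau : a b / a + b}) (tauC : forall a b, tau (a * b) = tau (b * a)).

Lemma tau0 : tau 0 = 0.
Proof. by apply: (addrI (tau 0)); rewrite -tauD !addr0. Qed.

Definition tau_tr (M : 'M[D]_m.-1.+1) : algC := tau (\tr M).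

Lemma tau_trD : {morph tau_tr : M N / M + N}.
Proof. by move=> M N; rewrite /tau_tr mxtraceD tauD. Qed.

Lemma tau_trC M N : tau_tr (M * N) = tau_tr (N * M).
Proof.
rewrite /tau_tr /mxtrace !(big_morph tau tauD tau0).
under eq_bigr do rewrite mxE (big_morph tau tauD tau0).
under [RHS]eq_bigr do rewrite mxE (big_morph tau tauD tau0).
by rewrite exchange_big; apply: eq_bigr => i _; apply: eq_bigr => j _; apply: tauC.
Qed.

Lemma tau_tr_scalar (c : D) (l : algC) M : (forall a, tau (c * a) = l * tau a) ->
  tau_tr (c%:M * M) = l * tau_tr M.
Proof.
move=> tauc; rewrite /tau_tr /mxtrace !(big_morph tau tauD tau0) mulr_sumr.
by apply: eq_bigr => i _; rewrite -[_ * M]/(_ *m M) mul_scalar_mx mxE tauc.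
Qed.

Variable i : Iirr G.
Hypotheses (vz : VZ_group G) (nl_i : i \in nl G) (sZB : 'Z(G) \subset B).
Hypothesis tau_center :
  {in 'Z(G), forall z a, tau (mu z * a) = 'chi_(central_irr i) z * tau a}.
Hypothesis tau_deg : m%:R * tau 1 = 'chi_i 1%g.

(** The trace at [g ^ h = g * [~ g, h]] is the trace at [g], but it is also the trace at [g] times
    [lam [~ g, h]], where [lam] is the central character; so it vanishes at a non-central [g], as
    does [i]. *)
Lemma ind_mx_trace : {in G, forall g, tau_tr (ind_mx g) = 'chi_i g}.
Proof.
have tr_center z M : z \in 'Z(G) -> tau_tr (ind_mx z * M) = 'chi_(central_irr i) z * tau_tr M.
  move=> Zz; rewrite ind_mx_scalar ?(subsetP sZB) //.
  exact/tau_tr_scalar/tau_center.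
move=> g Gg; have [Zg|nZg] := boolP (g \in 'Z(G)).
  rewrite chi_center // -[ind_mx g]mulr1 tr_center // mulrC; congr (_ * _).
  rewrite /tau_tr /mxtrace -tau_deg (big_morph tau tauD tau0).
  under eq_bigr do rewrite mxE eqxx mulr1n.
  by rewrite sumr_const card_ord prednK ?indexg_gt0 // mulr_natl.
rewrite (vz nl_i) ?in_setD ?nZg //.
have [h Gh gh] : exists2 h, h \in G & 'chi_(central_irr i) [~ g, h]%g != 1.
  apply/exists_inP; apply: contraR nZg; rewrite negb_exists_in => /forall_inP all1.
  by apply: (vz_nondegenerate vz nl_i Gg) => h /all1; rewrite negbK => /eqP.
have Zc : [~ g, h]%g \in 'Z(G) by apply: (subsetP (vz_der_sub vz)); apply: mem_commg.
have Gc := subsetP (center_sub G) _ Zc; have Gh' : (h^-1)%g \in G by rewrite groupV.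
have : tau_tr (ind_mx (g ^ h)%g) = tau_tr (ind_mx g).
  by rewrite conjgE ind_mxM ?groupM // ind_mxM // tau_trC -mulrA -ind_mxM // mulgV ind_mx1 mulr1 //.
rewrite conjg_mulR; have /centerP[_ cc] := Zc; rewrite -(cc _ Gg) ind_mxM // tr_center //.
move/eqP; rewrite -subr_eq0 -{2}[tau_tr _]mul1r -mulrBl mulf_eq0 subr_eq0 (negPf gh).
by move/eqP.
Qed.

End Trace.

End Induced.

(** * Realization of the non-linear characters *)

Lemma schur_index_leq (gT : finGroupType) (G : {group gT}) (i : Iirr G) m :
  realizable_in_degree 'chi_i m -> (schur_index i <= m)%N.
Proof. by move=> rm; rewrite /schur_index; case: ex_minnP => k _; apply; apply/asboolP. Qed.

Lemma schur_index_realizable (gT : finGroupType) (G : {group gT}) (i : Iirr G) :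
  realizable_in_degree 'chi_i (schur_index i).
Proof. by rewrite /schur_index; case: ex_minnP => k /asboolP. Qed.

Lemma realizable_of_hom (gT : finGroupType) (G : {group gT}) (i : Iirr G)
    (L : fieldExtType rat) (iota : {rmorphism L -> algC}) (n : nat) (rho : gT -> 'M[L]_n.+1) :
    rho 1%g = 1 -> {in G &, {morph rho : x y / (x * y)%g >-> x * y}} ->
    {in G, forall x, iota (\tr (rho x)) = 'chi_i x} ->
  realizable_in_degree 'chi_i (\dim_(<<1 & [seq \tr (rho x) | x <- enum G]>>) {:L}).
Proof.
move=> rho1 rhoM tr_rho; have rho_repr : mx_repr G rho by [].
exists L, iota, n.+1, (MxRepresentation rho_repr), [seq \tr (rho x) | x <- enum G]; split=> //.
  by apply/cfun_inP=> x Gx; rewrite cfunE Gx mulr1n -tr_rho // -trace_map_mx.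
by rewrite -map_comp; apply/eq_in_map => x; rewrite mem_enum /= => /tr_rho.
Qed.

Lemma schur_index_gt0 (gT : finGroupType) (G : {group gT}) (i : Iirr G) :
  (0 < schur_index i)%N.
Proof.
have [L [iota [n [rG [s [_ _ ->]]]]]] := schur_index_realizable i.
by rewrite divn_gt0 ?adim_gt0 // dimvS // subvf.
Qed.

(** If [E = C R] is a full rank factorization, then [R C] is the identity of size the rank. *)
Lemma tr_idempotent (F : fieldType) n (E : 'M[F]_n) : E *m E = E -> \tr E = (\rank E)%:R.
Proof.
move=> EE; suff RC : row_base E *m col_base E = 1%:M.
  by rewrite -{1}[E]mulmx_base mxtrace_mulC RC mxtrace1.
apply: (row_full_inj (col_base_full E)); apply: (row_free_inj (row_base_free E)).
by rewrite /= mulmx1 mulmx_base -[col_base E *m _ *m _]mulmxA -mulmxA mulmxA !mulmx_base.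
Qed.

(** The quaternion group has no faithful representation of dimension two over a formally
    real field: [v], [v *m X] and [v *m Y] are independent, since multiplying a relation
    [a v + b v X + c v Y = 0] by the conjugate [a - b X - c Y] gives
    [(a ^+ 2 + b ^+ 2 + c ^+ 2) v = 0]. *)
Lemma quaternion_line_rank (F : fieldType) (n : nat) (X Y E : 'M[F]_n) (v : 'rV[F]_n) :
    (forall a b c : F, a ^+ 2 + b ^+ 2 + c ^+ 2 = 0 -> [/\ a = 0, b = 0 & c = 0]) ->
    v != 0 -> v *m X *m X = - v -> v *m Y *m Y = - v ->
    v *m X *m Y = - (v *m Y *m X) ->
    (v <= E)%MS -> (v *m X <= E)%MS -> (v *m Y <= E)%MS ->
  (2 < \rank E)%N.
Proof.
move=> anisotropic v_neq0 vXX vYY vXY vE vXE vYE; rewrite ltnNge; apply/negP=> rankE.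
pose M : 'M[F]_(3, n) := \matrix_(k < 3) [:: v; v *m X; v *m Y]`_k.
have rankM : (\rank M <= 2)%N.
  apply: leq_trans rankE; apply: mxrankS; apply/row_subP=> k; rewrite rowK.
  by case: k => [[|[|[|]]]].
have [w w_neq0 wM] : exists2 w : 'rV_3, w != 0 & w *m M = 0.
  have : kermx M != 0 by rewrite kermx_eq0 /row_free; apply: contraL rankM => /eqP->.
  by case/rowV0Pn=> w /sub_kermxP wM w0; exists w.
pose a := w 0 0; pose b := w 0 1; pose c := w 0 2%:R.
have rel : a *: v + b *: (v *m X) + c *: (v *m Y) = 0.
  move: wM; rewrite mulmx_sum_row !big_ord_recl big_ord0 !rowK /= addr0 addrA.
  by congr (_ *: _ + _ *: _ + _ *: _ = 0); congr (w 0 _); apply/val_inj.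
have : (a *: v + b *: (v *m X) + c *: (v *m Y)) *m (a%:M - b *: X - c *: Y)
   = (a ^+ 2 + b ^+ 2 + c ^+ 2) *: v.
  rewrite !mulmxDl !mulmxBr !mul_mx_scalar -!scalemxAl -!scalemxAr vXX vYY vXY.
  move: (v *m X) (v *m Y) (v *m Y *m X) => x y z.
  by apply/rowP=> k; rewrite !mxE; ring.
rewrite rel mul0mx => /esym/eqP; rewrite scaler_eq0 (negPf v_neq0) orbF => /eqP.
case/anisotropic=> a0 b0 c0; case/eqP: w_neq0; apply/rowP=> k; rewrite mxE.
case: k => [[|[|[|]]]] //= ltk.
- by rewrite -[RHS]a0; congr (w 0 _); apply/val_inj.
- by rewrite -[RHS]b0; congr (w 0 _); apply/val_inj.
by rewrite -[RHS]c0; congr (w 0 _); apply/val_inj.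
Qed.

Section Realization.

Variables (gT : finGroupType) (G : {group gT}).
Hypotheses (vz : VZ_group G) (pG : 2.-group G).
Variable i : Iirr G.
Hypothesis nl_i : i \in nl G.

Local Notation Z := 'Z(G).
Local Notation lam := 'chi_(central_irr i).
Local Notation d := #[lam]%CF.

Let lin_lam : lam \is a linear_char := central_irr_lin i.
Let sG'Z := vz_der_sub vz.
Let nondeg := fun g => @vz_nondegenerate _ _ vz i g nl_i.

Lemma nl_degree : exists2 n, 'chi_i 1%g = n%:R & (n ^ 2 = #|G : Z|)%N.
Proof.
exists (irr_degree (socle_of_Iirr i)); first exact: irr1_degree.
by apply/eqP; rewrite -(eqr_nat algC) natrX -irr1_degree vz_degree.
Qed.

Lemma central_irr_prim_root : exists2 z, z \in Z & d.-primitive_root (lam z).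
Proof. exact: (lin_char_prim_root _ (pgroupS (center_sub G) pG)). Qed.

Lemma central_irr_order_gt0 : (0 < d)%N. Proof. exact: cforder_lin_char_gt0. Qed.

Lemma central_irr_cyclotomic_type : cyclotomic_type d i.
Proof.
have [n Dn _] := nl_degree; split=> [x Gx|].
  have [Zx|nZx] := boolP (x \in Z).
    by exists n, (lam x); [apply: lam_exp | rewrite chi_center // Dn].
  by exists 0%N, 1; rewrite ?expr1n // mul0r (vz nl_i) // in_setD nZx.
have [z Zz prim] := central_irr_prim_root; exists z; first exact: (subsetP (center_sub G)).
by exists (lam z); rewrite // chi_center.
Qed.

(** The order is a power of 2, and it is not 1 because [lam] is not trivial on [G']. *)
Lemma central_irr_order_cases : d = 2%N \/ (4 %| d)%N.
Proof.
have [N DN] := p_natP (pgroupS (center_sub G) pG).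
have := cforder_lin_char_dvdG lin_lam; rewrite DN => /(dvdn_pfactor _ _ (isT : prime 2))[k _].
case: k => [|[|k]] Dd; [|by left|by right; rewrite Dd !expnS mulnA dvdn_mulr].
case/negP: (central_irr_der vz nl_i); apply/subsetP=> x /(subsetP sG'Z) Zx.
rewrite ker_center // Zx /=; apply/eqP; rewrite -[lam x]expr1; rewrite expn0 in Dd.
by rewrite -[X in _ ^+ X]Dd lam_exp.
Qed.

(** The summary of [ind_mx_trace] and [block_gal_orbit]: only [mu] and the form [tau] depend on the
    case at hand. *)
Lemma block_ind (H : {group gT}) (D : algType rat) (mu : gT -> D) (tau : D -> algC)
    (m e n : nat) :
    H \subset G -> Z \subset H -> mu 1%g = 1 ->
    {in H &, {morph mu : x y / (x * y)%g >-> x * y}} ->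
    {morph tau : a b / a + b} -> (forall a b, tau (a * b) = tau (b * a)) ->
    (forall c a, tau (c *: a) = ratr c * tau a) ->
    {in Z, forall z a, tau (mu z * a) = lam z * tau a} ->
    #|G : H|%g = m -> m%:R * tau 1 = n%:R -> 'chi_i 1%g = n%:R ->
    embeds D e -> (m ^ 2 * e <= totient d * n ^ 2)%N ->
  block (mxalg m D : algType rat) (gal_orbit d i).
Proof.
move=> sHG sZH mu1 muM tauD tauC tauZ tau_mu <- tau1 Dn embD le_m.
have tr_ind := ind_mx_trace sHG mu1 muM tauD tauC vz nl_i sZH tau_mu (etrans tau1 (esym Dn)).
apply: (block_gal_orbit (rho := ind_mx G H mu : gT -> mxalg #|G : H|%g D) (t := tau_tr tau (B := H))
   _ _ _ _ tr_ind Dn central_irr_cyclotomic_type (embeds_mx (indexg_gt0 G H) embD) le_m).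
- exact: ind_mx1.
- exact: ind_mxM.
- exact: tau_trD.
move=> c M; rewrite /tau_tr /mxtrace !(big_morph tau tauD (tau0 tauD)) mulr_sumr.
by apply: eq_bigr => k _; rewrite -tauZ mxE.
Qed.

Lemma fmorph_ratZ (L : fieldExtType rat) (iota : {rmorphism L -> algC}) c a :
  iota (c *: a) = ratr c * iota a.
Proof. by rewrite -mulr_algl rmorphM alg_num_field fmorph_rat. Qed.

(** The values of [lam] are [d]-th roots of unity, which are all in the image of [Q(zeta_d)]. *)
Lemma Qzeta_lift (iota : {rmorphism Qzeta d -> algC}) :
  exists lamL : gT -> Qzeta d,
    [/\ {in Z, forall z, iota (lamL z) = lam z},
        {in Z &, {morph lamL : x y / (x * y)%g >-> x * y}}
      & {in Z, forall z, lam z = 1 -> lamL z = 1}].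
Proof.
have ex z : exists x, z \in Z -> iota x = lam z.
  have [Zz|_] := boolP (z \in Z); last by exists 0.
  by have [x] := Qzeta_root central_irr_order_gt0 iota (lam_exp lam Zz); exists x.
have [lamL lamLE] := boolp.choice ex; exists lamL; split=> // [x y Zx Zy|z Zz lz].
  by apply: (fmorph_inj iota); rewrite rmorphM !lamLE ?groupM // lin_charM.
by apply: (fmorph_inj iota); rewrite lamLE // rmorph1.
Qed.

Section Split.

Variable (K : {group gT}) (maxK : maxgroup K (meets_center_in_ker lam)).
Local Notation A := (Z <*> K)%G.
Hypothesis eqAB : Kperp lin_lam sG'Z maxK = A :> {set gT}.

Lemma index_split n : 'chi_i 1%g = n%:R -> #|G : A|%g = n.
Proof.
move=> Dn; have [n' Dn' cardn] := nl_degree.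
have <- : n' = n by apply/eqP; rewrite -(eqr_nat algC) -Dn' Dn.
apply/eqP; rewrite -eqn_sqr cardn; apply/eqP/(index_sqr (sZK_G lin_lam sG'Z maxK)).
by rewrite -(card_Kperp_ZK lin_lam sG'Z nondeg maxK) eqAB mulnn.
Qed.

Lemma block_split n : 'chi_i 1%g = n%:R ->
  block (mxalg n (Qzeta d) : algType rat) (gal_orbit d i).
Proof.
move=> Dn; have [iota] := Qzeta_embedding d; have [lamL [lamLE lamLM lamL1]] := Qzeta_lift iota.
have [e embL le_e] := embeds_Qzeta central_irr_order_gt0.
apply: (@block_ind A (Qzeta d : algType rat) (extend G K lamL) iota n e n) => //.
- exact: (sZK_G lin_lam sG'Z maxK).
- exact: sZ_ZK.
- exact: (extend1 lin_lam maxK).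
- exact: (extendM lin_lam maxK).
- exact: rmorphD.
- by move=> a b; rewrite mulrC.
- exact: fmorph_ratZ.
- by move=> z Zz a; rewrite (extend_center lin_lam maxK) // rmorphM lamLE.
- exact: index_split.
- by rewrite rmorph1 mulr1.
by rewrite mulnC leq_mul2r le_e orbT.
Qed.

Lemma block_split2 n : d = 2%N -> 'chi_i 1%g = n%:R ->
  block (mxalg n (rat^o : algType rat) : algType rat) (gal_orbit d i).
Proof.
move=> d2 Dn.
apply: (@block_ind A (rat^o : algType rat) (extend G K (lam_rat lam)) (@ratr algC) n 1 n) => //.
- exact: (sZK_G lin_lam sG'Z maxK).
- exact: sZ_ZK.
- exact: (extend1 lin_lam maxK (lam_ratM lin_lam d2) (@lam_rat_ker _ _ _)).
- exact: (extendM lin_lam maxK (lam_ratM lin_lam d2) (@lam_rat_ker _ _ _)).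
- exact: rmorphD.
- by move=> a b; rewrite mulrC.
- by move=> c a; rewrite -rmorphM.
- move=> z Zz a; rewrite (extend_center lin_lam maxK (lam_ratM lin_lam d2) (@lam_rat_ker _ _ _)) //.
  by rewrite rmorphM /= ratr_lam_rat.
- exact: index_split.
- by rewrite rmorph1 mulr1.
- exact: embeds_rat.
by rewrite d2 muln1 mul1n.
Qed.

(** The representation induced from [Z * K] has coefficients in [Q(zeta_d)], and the value of
    the character at a suitable central element generates this field. *)
Lemma schur_index_split : (schur_index i <= 1)%N.
Proof.
have [n Dn _] := nl_degree.
have [iota] := Qzeta_embedding d; have [lamL [lamLE lamLM lamL1]] := Qzeta_lift iota.
have sAG' := sZK_G lin_lam sG'Z maxK.
have ext1 := extend1 lin_lam maxK lamLM lamL1.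
have extM := extendM lin_lam maxK lamLM lamL1.
have tr_ind : {in G, forall x, iota (\tr (ind_mx G A (extend G K lamL) x)) = 'chi_i x}.
  apply: (ind_mx_trace (tau := iota) sAG' ext1 extM _ _ vz nl_i).
  - exact: rmorphD.
  - by move=> a b; rewrite mulrC.
  - exact: sZ_ZK.
  - by move=> z Zz a; rewrite (extend_center lin_lam maxK) // rmorphM lamLE.
  by rewrite rmorph1 mulr1 (index_split Dn).
have := schur_index_leq (realizable_of_hom (ind_mx1 sAG' ext1) (ind_mxM sAG' extM) tr_ind).
set trs := [seq _ | _ <- _]; suff -> : <<1 & trs>>%VS = fullv.
  by rewrite divnn => /leq_trans; apply; apply: leq_b1.
have [z Zz prim_z] := central_irr_prim_root; have Gz := subsetP (center_sub G) z Zz.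
have [z0 prim_z0 gen_z0] := QzetaP central_irr_order_gt0.
have Utr : \tr (ind_mx G A (extend G K lamL) z) \in <<1 & trs>>%VS.
  by apply: seqv_sub_adjoin; apply: map_f; rewrite mem_enum.
have Uz : lamL z \in <<1 & trs>>%VS.
  have n_neq0 : n%:R != 0 :> rat.
    by rewrite pnatr_eq0 -(pnatr_eq0 algC) -Dn irr1_neq0.
  suff -> : lamL z = n%:R^-1 *: \tr (ind_mx G A (extend G K lamL) z) by apply: memvZ.
  apply: (canRL (scalerK n_neq0)); apply: (fmorph_inj iota).
  by rewrite tr_ind // chi_center // fmorph_ratZ lamLE // ratr_nat Dn.
have prim_lz : d.-primitive_root (lamL z) by rewrite -(fmorph_primitive_root iota) lamLE.
have [a Dz0] := prim_rootP prim_lz (prim_expr_order prim_z0).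
apply/eqP; rewrite eqEsubv subvf -gen_z0; apply/FadjoinP; split; first exact: sub1v.
by rewrite Dz0; apply: rpredX.
Qed.

End Split.

Section Quaternionic.

Variable (K : {group gT}) (maxK : maxgroup K (meets_center_in_ker lam)).
Hypothesis d2 : d = 2%N.
Local Notation A := (Z <*> K)%G.
Local Notation B := (Kperp lin_lam sG'Z maxK).

Variables g h : gT.
Hypotheses (Bg : g \in B) (Bh : h \in B).
Hypotheses (lam_g2 : lam (g ^+ 2)%g = -1) (lam_h2 : lam (h ^+ 2)%g = -1).
Hypothesis (form_gh : lam [~ g, h]%g = -1).

Let sBG' : B \subset G := sKperp_G lin_lam sG'Z maxK.
Let sAB' : A \subset B := sZK_Kperp lin_lam sG'Z maxK.
Let sZA' : Z \subset A := sZ_ZK G K.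
Let sZB' : Z \subset B := subset_trans sZA' sAB'.
Local Notation P := (perp_g Bg).
Local Notation qhom := (quat_hom lam K g h).

Lemma card_Kperp_double : #|B| = #|P|.*2.
Proof. exact: (card_Kperp_perp_g d2 Bg Bh form_gh). Qed.

Lemma card_perp_g_double : #|P| = #|A|.*2.
Proof. exact: (card_perp_g nondeg d2 Bg Bh lam_g2 form_gh). Qed.

Lemma index_perp_g n : 'chi_i 1%g = n%:R -> #|G : P|%g = n.
Proof.
move=> Dn; have [n' Dn' cardn] := nl_degree.
have <- : n' = n by apply/eqP; rewrite -(eqr_nat algC) -Dn' Dn.
have sPG : P \subset G := subset_trans (perp_g_Kperp Bg) sBG'.
apply/eqP; rewrite -eqn_sqr cardn; apply/eqP/(index_sqr sPG).
exact: (card_perp_g_sqr nondeg d2 Bg Bh lam_g2 form_gh).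
Qed.

(** [perp_g] has index [n] in [G] and index 2 in [Kperp]. *)
Lemma index_Kperp n : 'chi_i 1%g = n%:R -> n = #|G : B|%g.*2.
Proof.
move=> Dn; have sPG : P \subset G := subset_trans (perp_g_Kperp Bg) sBG'.
apply/eqP; rewrite -(eqn_pmul2l (cardG_gt0 P)) -{1}(index_perp_g Dn) Lagrange //.
by rewrite -(Lagrange sBG') card_Kperp_double -!muln2 mulnAC -mulnA.
Qed.

Lemma tau_quat_center z a : z \in Z -> ratr (2 * quat_re (qhom z * a)) = lam z * ratr (2 * quat_re a) :> algC.
Proof.
move=> Zz; rewrite (quat_hom_center d2 Bg Bh form_gh) // -scalerAl mul1r.
rewrite -(ratr_lam_rat d2 Zz) -rmorphM; congr ratr.
by case: a => a b c e /=; rewrite mulrCA.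
Qed.

Lemma block_quat n : 'chi_i 1%g = n%:R ->
  block (mxalg n./2 (quat rat : algType rat) : algType rat) (gal_orbit d i).
Proof.
move=> Dn; have n2 := index_Kperp Dn.
apply: (@block_ind B (quat rat : algType rat) qhom (fun q => ratr (2 * quat_re q)) n./2 4 n) => //.
- exact: (quat_hom1 d2 Bg Bh form_gh).
- exact: (quat_homM nondeg d2 Bg Bh lam_g2 lam_h2 form_gh).
- by case=> a1 b1 c1 e1 [a2 b2 c2 e2] /=; rewrite mulrDr rmorphD.
- by case=> a1 b1 c1 e1 [a2 b2 c2 e2] /=; congr ratr; ring.
- by move=> c [a1 b1 c1 e1] /=; rewrite -rmorphM; congr ratr; rewrite mulrCA.
- by move=> z Zz a; apply: tau_quat_center.
- by rewrite n2 doubleK.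
- by rewrite [in RHS]n2 n2 doubleK /= mulr1 rmorph_nat -natrM muln2.
- exact: embeds_quat.
by rewrite d2 mul1n {2}n2 -muln2 expnMn n2 doubleK.
Qed.

(** On [perp_g], the quaternions [quat_hom] are in the subfield generated by the first unit, which
    is embedded in [Q(zeta_4)]; the character is induced from the resulting homomorphism. *)
Lemma schur_index_quat_leq : (schur_index i <= 2)%N.
Proof.
have [n Dn _] := nl_degree.
have [iota] := Qzeta_embedding 4; have [I prim_I _] := QzetaP (isT : (0 < 4)%N).
have I2 : I ^+ 2 = -1.
  have : (I ^+ 2 - 1) * (I ^+ 2 + 1) = 0.
    by rewrite -subr_sqr expr1n -exprM (prim_expr_order prim_I) subrr.
  move/eqP; rewrite mulf_eq0 subr_eq0 addr_eq0 => /orP[|/eqP //].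
  by rewrite -(prim_order_dvd prim_I).
pose toQ4 (q : quat rat) : Qzeta 4 := in_alg _ (quat_re q) + in_alg _ (quat_i q) * I.
pose mu x := toQ4 (qhom x).
have sPG : P \subset G := subset_trans (perp_g_Kperp Bg) sBG'.
have sZP : Z \subset P := subset_trans sZA' (sZK_perp_g Bg).
have mu1 : mu 1%g = 1.
  by rewrite /mu (quat_hom1 d2 Bg Bh form_gh) /toQ4 /= scale0r scale1r mul0r addr0.
have muM : {in P &, {morph mu : x y / (x * y)%g >-> x * y}}.
  move=> x y Px Py; have [Bx By] := (subsetP (perp_g_Kperp Bg) x Px, subsetP (perp_g_Kperp Bg) y Py).
  rewrite /mu (quat_homM nondeg d2 Bg Bh lam_g2 lam_h2 form_gh) //.
  have := quat_hom_perp_g Bh form_gh Px; have := quat_hom_perp_g Bh form_gh Py.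
  case: (qhom x) (qhom y) => [a b c e] [a' b' c' e'] /= [-> ->] [-> ->].
  have -> : Quat a b 0 0 * Quat a' b' 0 0 = Quat (a * a' - b * b') (a * b' + b * a') 0 0.
    by congr Quat; ring.
  rewrite /toQ4 /=.
  rewrite -![_%:A]/(in_alg (Qzeta 4) _) rmorphB rmorphD !rmorphM.
  have -> u v : u - v = u + v * I ^+ 2 by rewrite I2 mulrN1.
  ring.
have tau_mu : {in Z, forall z a, iota (mu z * a) = lam z * iota a}.
  move=> z Zz a; rewrite rmorphM; congr (_ * _).
  rewrite /mu (quat_hom_center d2 Bg Bh form_gh) // /toQ4 /= mulr0 scale0r mul0r addr0 mulr1.
  by rewrite fmorph_ratZ rmorph1 mulr1 ratr_lam_rat.
have tr_ind : {in G, forall x, iota (\tr (ind_mx G P mu x)) = 'chi_i x}.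
  apply: (ind_mx_trace (tau := iota) sPG mu1 muM _ _ vz nl_i sZP tau_mu).
  - exact: rmorphD.
  - by move=> a b; rewrite mulrC.
  by rewrite rmorph1 mulr1 (index_perp_g Dn).
apply: leq_trans (schur_index_leq (realizable_of_hom (ind_mx1 sPG mu1) (ind_mxM sPG muM) tr_ind)) _.
by apply: leq_trans (leq_div _ _) (@dim_Qzeta_leq 4 isT).
Qed.


Lemma card_ZK_degree n : 'chi_i 1%g = n%:R -> (#|A|.*2 = n * #|Z|)%N.
Proof.
move=> Dn; have sPG : P \subset G := subset_trans (perp_g_Kperp Bg) sBG'.
rewrite -card_perp_g_double; apply/eqP; rewrite -(eqn_pmul2l (cardG_gt0 P)) mulnn.
rewrite (card_perp_g_sqr nondeg d2 Bg Bh lam_g2 form_gh) mulnA -{1}(index_perp_g Dn).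
by rewrite Lagrange.
Qed.

(** As [i] has rational values, a representation [rG] of [i] realized in degree 1 is defined over
    a field [L] that coincides with [Q]. The part of [rG] on which [Z * K] acts through the extension of [lam] has dimension 2 and is
    stable under [g] and [h], in contradiction with [quaternion_line_rank]. *)
Lemma quat_not_realizable : ~ realizable_in_degree 'chi_i 1.
Proof.
case=> L [iota [N [rG [s [Dchi Ds dimL]]]]].
have [n Dn _] := nl_degree.
have tr_rG x : x \in G -> iota (\tr (rG x)) = 'chi_i x.
  by move=> Gx; rewrite -Dchi cfunE Gx mulr1n -trace_map_mx.
have ratL (x : L) : exists q : rat, x = q%:A.
  have sU : (<<1 & s>> <= 1)%VS.
    apply/Fadjoin_seqP; split=> [|y sy]; first exact: subvv.
    have : iota y \in [seq 'chi_i x | x <- enum G] by rewrite -Ds map_f.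
    case/mapP=> z; rewrite mem_enum => Gz Dy.
    suff [q Dq] : exists q : rat, iota y = ratr q.
      have -> : y = q%:A by apply: (fmorph_inj iota); rewrite Dq fmorph_ratZ rmorph1 mulr1.
      exact: rpredZ (rpred1 _).
    rewrite Dy; have [Zz|nZz] := boolP (z \in Z).
      by exists (n%:R * lam_rat lam z); rewrite chi_center // Dn rmorphM /= ratr_lam_rat // ratr_nat.
    by exists 0; rewrite (vz nl_i) ?rmorph0 // in_setD nZz.
  have U1 : <<1 & s>>%VS = 1%VS by apply/eqP; rewrite eqEsubv sU sub1v.
  have : \dim {:L} = 1%N by move: dimL; rewrite U1 dimv1 divn1.
  move=> dim1; have full1 : (1%VS : {vspace L}) = fullv.
    by apply/eqP; rewrite -(dimv_leqif_eq (subvf _)) dimv1 dim1.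
  have /vlineP[q ->] : x \in 1%VS by rewrite full1 memvf.
  by exists q.
pose ext := extend G K (lam_rat lam).
have extM : {in A &, {morph ext : x y / (x * y)%g >-> x * y}}.
  exact: (extendM lin_lam maxK (lam_ratM lin_lam d2) (@lam_rat_ker _ _ _)).
have ext1 : ext 1%g = 1 by apply: (extend1 lin_lam maxK (lam_ratM lin_lam d2) (@lam_rat_ker _ _ _)).
have extZ z : z \in Z -> ext z = lam_rat lam z.
  exact: (extend_center lin_lam maxK (lam_ratM lin_lam d2) (@lam_rat_ker _ _ _)).
have extJ x y : x \in A -> y \in B -> ext (x ^ y)%g = ext x.
  exact: (extendJ (lam_ratM lin_lam d2) (@lam_rat_ker _ _ _)).
pose mu x : L := in_alg L (ext x).
have muM : {in A &, {morph mu : x y / (x * y)%g >-> x * y}}.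
  by move=> x y Ax Ay; rewrite /mu extM // rmorphM.
have mu1 : mu 1%g = 1 by rewrite /mu ext1 rmorph1.
have sAG' : A \subset G := subset_trans sAB' sBG'.
(* Up to the factor [#|A|], [S] is the projection on the part where [A] acts by [mu]. *)
pose S := \sum_(a in A) mu a^-1%g *: rG a.
have SrA b : b \in A -> S *m rG b = mu b *: S.
  move=> Ab; rewrite mulmx_suml scaler_sumr [RHS](reindex_inj (mulIg b)) /=.
  apply: eq_big => [a|a Aa]; first by rewrite groupMr.
  rewrite -scalemxAl -repr_mxM ?(subsetP sAG') // scalerA; congr (_ *: _).
  by rewrite invMg muM ?groupV // mulrA -muM ?groupV // mulgV mu1 mul1r.
have SrB q : q \in B -> S *m rG q = rG q *m S.
  move=> Bq; rewrite mulmx_suml mulmx_sumr [RHS](reindex_inj (conjg_inj q)) /=.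
  have Gq := subsetP sBG' q Bq; have nAq := Kperp_norm_ZK Bq.
  apply: eq_big => [a|a Aa]; first by rewrite memJ_norm.
  have Ga := subsetP sAG' a Aa.
  rewrite -scalemxAl -scalemxAr -!repr_mxM ?groupJ // -conjgC; congr (_ *: _).
  by rewrite -conjVg /mu extJ // groupV.
have SS : S *m S = #|A|%:R *: S.
  rewrite {2}/S mulmx_sumr (eq_bigr (fun=> S)) => [|a Aa].
    by rewrite sumr_const scaler_nat.
  by rewrite -scalemxAr SrA // scalerA -muM ?groupV // mulVg mu1 scale1r.
have A_neq0 : #|A|%:R != 0 :> L.
  by rewrite -(fmorph_eq0 iota) rmorph_nat neq0CG.
pose E := #|A|%:R^-1 *: S.
have EE : E *m E = E.
  by rewrite -scalemxAl -scalemxAr SS (scalerA _ _ S) mulVf // scale1r.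
(* Off the centre, the terms of the trace of [S] vanish; at the centre they are equal to [n]. *)
have rankE : \rank E = 2%N.
  apply/eqP; rewrite -(eqr_nat algC) -(rmorph_nat iota) -tr_idempotent //.
  rewrite mxtraceZ raddf_sum rmorphM fmorphV rmorph_nat rmorph_sum /=.
  rewrite (bigID (fun a => a \in Z)) /= [X in _ + X]big1 ?addr0; last first.
    move=> a /andP[Aa nZa]; have Ga := subsetP sAG' a Aa.
    by rewrite mxtraceZ rmorphM tr_rG // (vz nl_i) ?mulr0 // in_setD nZa.
  rewrite (eq_bigr (fun=> n%:R)) => [|z /andP[Az Zz]]; last first.
    have Gz := subsetP sAG' z Az; rewrite mxtraceZ rmorphM tr_rG // chi_center // Dn.
    rewrite /mu fmorph_ratZ rmorph1 mulr1 extZ ?groupV // ratr_lam_rat ?groupV //.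
    by rewrite mulrCA -lin_charM ?groupV // mulVg lin_char1 // mulr1.
  rewrite sumr_const (eq_card (B := mem Z)) => [|z]; last first.
    by apply/andP/idP => [[]//|Zz]; split=> //; apply: (subsetP sZA').
  rewrite -[n%:R *+ _]mulr_natr -natrM -(card_ZK_degree Dn) -muln2 natrM mulKf //.
  by rewrite -(rmorph_nat iota) fmorph_eq0.
have ErA b : b \in A -> E *m rG b = mu b *: E.
  by move=> Ab; rewrite -scalemxAl SrA // !scalerA mulrC.
have ErB q : q \in B -> E *m rG q = rG q *m E.
  by move=> Bq; rewrite -scalemxAl SrB // -scalemxAr.
pose v := nz_row E.
have vE : (v <= E)%MS by apply: nz_row_sub.
have v_neq0 : v != 0 by rewrite nz_row_eq0 -mxrank_eq0 rankE.
have vrA b : b \in A -> v *m rG b = mu b *: v.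
  by move=> Ab; have /submxP[u ->] := vE; rewrite -mulmxA ErA // -scalemxAr.
have vrB q : q \in B -> (v *m rG q <= E)%MS.
  move=> Bq; have /submxP[u ->] := vE; rewrite -mulmxA ErB // mulmxA; exact: submxMl.
have [Gg Gh] : g \in G /\ h \in G by split; apply: (subsetP sBG').
have mu_center z : z \in Z -> lam z = -1 -> mu z = -1.
  move=> Zz lz; rewrite /mu extZ //.
  by rewrite (_ : lam_rat lam z = -1) ?rmorphN1 // (@lam_rat_eq _ _ _ d2 z (-1)) ?lz ?rmorphN1.
have Zg2 := sqr_center lin_lam sG'Z nondeg d2 Gg; have Zh2 := sqr_center lin_lam sG'Z nondeg d2 Gh.
have Zc := comm_center sG'Z Gg Gh.
have vgg : v *m rG g *m rG g = - v.
  by rewrite -mulmxA -repr_mxM // vrA ?(subsetP sZA') // mu_center // scaleN1r.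
have vhh : v *m rG h *m rG h = - v.
  by rewrite -mulmxA -repr_mxM // vrA ?(subsetP sZA') // mu_center // scaleN1r.
have vgh : v *m rG g *m rG h = - (v *m rG h *m rG g).
  rewrite -!mulmxA -!repr_mxM //.
  have -> : (g * h = [~ g, h] * (h * g))%g.
    have /centerP[_ cc] := Zc; rewrite (cc (h * g)%g) ?groupM //.
    by rewrite commgEl conjgE -!mulgA mulKVg mulKVg.
  have Gc := subsetP (center_sub G) _ Zc.
  rewrite (repr_mxM rG Gc (groupM Gh Gg)) mulmxA (vrA _ (subsetP sZA' _ Zc)).
  by rewrite mu_center // scaleN1r mulNmx.
have anisotropic (a b c : L) : a ^+ 2 + b ^+ 2 + c ^+ 2 = 0 -> [/\ a = 0, b = 0 & c = 0].
  have [[qa ->] [qb ->] [qc ->]] := And3 (ratL a) (ratL b) (ratL c).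
  rewrite -![_%:A]/(in_alg L _) -!rmorphXn -!rmorphD => /eqP; rewrite fmorph_eq0.
  rewrite !paddr_eq0 ?addr_ge0 ?sqr_ge0 // !sqrf_eq0 => /andP[/andP[/eqP-> /eqP->] /eqP->].
  by rewrite !rmorph0.
have := quaternion_line_rank anisotropic v_neq0 vgg vhh vgh vE (vrB g Bg) (vrB h Bh).
by rewrite rankE.
Qed.

Lemma schur_index_quat : schur_index i = 2%N.
Proof.
have := schur_index_quat_leq; have := schur_index_gt0 i; have := schur_index_realizable i.
case: (schur_index i) => [|[|[|]]] // /quat_not_realizable //.
Qed.

End Quaternionic.

End Realization.

(** * The decomposition *)

Section Decomposition.

Variables (gT : finGroupType) (G : {group gT}).
Hypotheses (vz : VZ_group G) (pG : 2.-group G).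

Local Notation Z := 'Z(G).
Local Notation QG := (galg rat (subg_of G)).
Local Notation aQ := (nb_cyclic (G / G^`(1))%g).
Local Notation a := (nb_cyclic Z).
Local Notation a' := (nb_cyclic (Z / G^`(1))%g).
Local Notation ord j := (#['chi_(central_irr j)]%CF).

Lemma in_nlC j : (j \in ~: nl G) = ('chi_j \is a linear_char).
Proof. by rewrite in_setC in_nl negbK. Qed.

Lemma card_lin_order d : (0 < d)%N ->
  #|[set j in ~: nl G | #['chi_j]%CF == d]| = (totient d * aQ d)%N.
Proof.
move=> d_gt0; rewrite -card_irr_ker_order ?der_normal ?sub_der1_abelian //.
by apply: eq_card => j; rewrite !inE -lin_irr_der1 qualifE /= irr_char andTb negbK.
Qed.

Lemma cyclotomic_type_lin d (j : Iirr G) : j \in ~: nl G -> #['chi_j]%CF = d ->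
  cyclotomic_type d j.
Proof.
rewrite in_nlC => lin_j <-; split=> [x Gx|].
  exists 1%N, ('chi_j x); last by rewrite mul1r.
  exact: (dvdn_cforderP (dvdnn _)).
have [z Gz prim] := lin_char_prim_root (isT : prime 2) pG lin_j.
by exists z => //; exists ('chi_j z); rewrite // lin_char1 // mul1r.
Qed.

Lemma realizes_lin d : (0 < d)%N ->
  realizes (copies (aQ d) (Qzeta d : algType rat)) [set j in ~: nl G | #['chi_j]%CF == d].
Proof.
move=> d_gt0; apply: (realizes_copies d_gt0); last exact: card_lin_order.
move=> j /setIdP[lin_j /eqP Dd]; have tj := cyclotomic_type_lin lin_j Dd.
split=> //.
  apply/subsetP=> y /imsetP[k _ ->]; rewrite in_set in_nlC aut_IirrE.
  by rewrite cfAut_lin_char cforder_aut Dd eqxx andbT -in_nlC.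
have [iota] := Qzeta_embedding d; have [e embL le_e] := embeds_Qzeta d_gt0.
have [val_j _] := tj; have lin : 'chi_j \is a linear_char by rewrite -in_nlC.
have ex x : exists y, x \in G -> iota y = 'chi_j x.
  have [Gx|_] := boolP (x \in G); last by exists 0.
  have xd : 'chi_j x ^+ d = 1 by rewrite -Dd; apply: (dvdn_cforderP (dvdnn _)).
  by have [y] := Qzeta_root d_gt0 iota xd; exists y.
have [rho rhoE] := boolp.choice ex.
apply: (@block_gal_orbit _ _ d (Qzeta d : algType rat) rho iota e 1) => //.
- by apply: (fmorph_inj iota); rewrite rhoE // rmorph1 lin_char1.
- by move=> x y Gx Gy; apply: (fmorph_inj iota); rewrite rmorphM !rhoE ?groupM // lin_charM.
- exact: rmorphD.
- exact: fmorph_ratZ.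
- exact: lin_char1.
by rewrite muln1.
Qed.

Lemma central_irr_aut (s : {rmorphism algC -> algC}) j :
  'chi_(central_irr (aut_Iirr s j)) = cfAut s 'chi_(central_irr j) :> 'CF(Z).
Proof.
apply/cfun_inP=> z Zz; apply: (mulfI (irr1_neq0 (aut_Iirr s j))).
rewrite -chi_center // aut_chi1 aut_IirrE !cfunE chi_center // rmorphM.
by rewrite irr1_degree rmorph_nat.
Qed.

Lemma gal_orbit_nl d j k : k \in gal_orbit d j -> j \in nl G -> k \in nl G /\ ord k = ord j.
Proof.
by case/imsetP=> l _ -> nl_j; split; [move: nl_j; rewrite !inE aut_chi1 | rewrite central_irr_aut cforder_aut].
Qed.

(** The two cases are [Kperp = Z * K] and its negation, for a maximal [K]. *)
Lemma nl_cases n j : j \in nl G -> 'chi_j 1%g = n%:R ->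
     [/\ (schur_index j <= 1)%N,
         block (mxalg n (Qzeta (ord j)) : algType rat) (gal_orbit (ord j) j) &
         ord j = 2%N -> block (mxalg n (rat^o : algType rat) : algType rat) (gal_orbit (ord j) j)]
  \/ [/\ schur_index j = 2%N, ord j = 2%N &
         block (mxalg n./2 (quat rat : algType rat) : algType rat) (gal_orbit (ord j) j)].
Proof.
move=> nl_j Dn; have [K maxK] := max_meets_center_in_ker 'chi_(central_irr j).
have [eqAB|neqAB] := eqVneq (Kperp (central_irr_lin j) (vz_der_sub vz) maxK : {set gT}) (Z <*> K)%G.
  left; split; first exact: (schur_index_split pG nl_j eqAB).
    exact: (block_split pG nl_j eqAB).
  by move=> d2; apply: (block_split2 pG nl_j eqAB).
right; have [d2|d4] := central_irr_order_cases vz pG nl_j; last first.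
  by case/eqP: neqAB; apply: Kperp_eq_ZK => // g; apply: vz_nondegenerate.
have nondeg := fun g => @vz_nondegenerate _ _ vz j g nl_j.
have [g [h [Bg Bh lg lh gh]]] := quaternion_generators nondeg d2 neqAB.
split=> //; first exact: (schur_index_quat nl_j d2 Bg Bh).
exact: (block_quat pG nl_j d2 Bg Bh).
Qed.

Lemma nl_order_pow j : j \in nl G -> ord j = 2%N \/ (4 <= ord j)%N.
Proof.
move=> nl_j; have [->|d4] := central_irr_order_cases vz pG nl_j; [by left | right].
exact: dvdn_leq (central_irr_order_gt0 j) d4.
Qed.

Section Degree.

Variable n : nat.
Hypothesis deg_n : {in nl G, forall j, 'chi_j 1%g = n%:R}.

Lemma realizes_nl d b : (0 < d)%N ->
    #|[set j in nl G | ord j == d]| = (totient d * b)%N -> (4 <= d)%N ->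
  realizes (copies b (mxalg n (Qzeta d) : algType rat)) [set j in nl G | ord j == d].
Proof.
move=> d_gt0 cardT d4; apply: (realizes_copies d_gt0) => // j /setIdP[nl_j /eqP Dd].
split; first by rewrite -Dd; apply: central_irr_cyclotomic_type.
  apply/subsetP=> k jk; have [nl_k Dk] := gal_orbit_nl jk nl_j.
  by apply/setIdP; rewrite nl_k Dk Dd.
have [[_ bj _]|[_ d2 _]] := nl_cases nl_j (deg_n nl_j); first by rewrite -Dd.
by move: d4; rewrite -Dd d2.
Qed.

(** [totient 2] is 1: a character with rational values is alone in its orbit. *)
Lemma gal_orbit2 j : j \in nl G -> ord j = 2%N -> gal_orbit 2 j = [set j].
Proof.
move=> nl_j d2; have tj : cyclotomic_type 2 j by rewrite -d2; apply: central_irr_cyclotomic_type.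
apply/eqP; rewrite eq_sym eqEcard sub1set gal_orbit_refl // cards1.
by rewrite card_gal_orbit.
Qed.

Lemma realizes_quat :
  realizes (copies #|[set j in nl G | schur_index j == 2%N]| (mxalg n./2 (quat rat : algType rat) : algType rat))
    [set j in nl G | schur_index j == 2%N].
Proof.
apply: (@realizes_copies _ _ 2) => [//|j|]; last by rewrite mul1n.
move=> Tj; have /setIdP[nl_j /eqP s2] := Tj.
have [[s1 _ _]|[_ d2 bj]] := nl_cases nl_j (deg_n nl_j); first by rewrite s2 in s1.
split; first by rewrite -d2; apply: central_irr_cyclotomic_type.
  by rewrite gal_orbit2 // sub1set.
by rewrite d2 in bj.
Qed.

Lemma realizes_rat b :
    #|[set j in nl G | (ord j == 2%N) && (schur_index j != 2%N)]| = b ->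
  realizes (copies b (mxalg n (rat^o : algType rat) : algType rat))
    [set j in nl G | (ord j == 2%N) && (schur_index j != 2%N)].
Proof.
move=> cardT; apply: (@realizes_copies _ _ 2) => [//|j|]; last by rewrite mul1n.
move=> Tj; have /setIdP[nl_j /andP[/eqP d2 s2]] := Tj.
have [[_ _ bj]|[s2' _ _]] := nl_cases nl_j (deg_n nl_j); last by rewrite s2' in s2.
split; first by rewrite -d2; apply: central_irr_cyclotomic_type.
  by rewrite gal_orbit2 // sub1set.
by move: (bj d2); rewrite d2.
Qed.

End Degree.

(** The degree is the square root of [#|G : Z|]; if there are no non-linear characters, then [G] is
    abelian and this is 1. *)
Lemma degree_exists : exists2 n, (n ^ 2 = #|(G / Z)%g|)%N &
  {in nl G, forall j, 'chi_j 1%g = n%:R}.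
Proof.
rewrite card_quotient ?normal_norm ?center_normal //.
have [nl0|[j nl_j]] := set_0Vmem (nl G).
  exists 1%N => [|j]; last by rewrite nl0 inE.
  have cGG : abelian G by apply/char_abelianP=> j; rewrite -in_nlC nl0 setC0 inE.
  by apply/esym/eqP; rewrite exp1n indexg_eq1 /= (center_idP cGG).
have [n Dn cardn] := nl_degree vz nl_j; exists n => // k nl_k.
have [m Dm cardm] := nl_degree vz nl_k.
by rewrite Dm; congr _%:R; apply/eqP; rewrite -eqn_sqr cardm cardn.
Qed.

Local Notation m1 := (exponent (G / G^`(1))%g).
Local Notation m2 := (exponent Z).
Local Notation m3 := (exponent (Z / G^`(1))%g).
Local Notation k := #|[set j in nl G | schur_index j == 2%N]|.

Lemma nb_cyclic_center_leq d : (0 < d)%N -> (a' d <= a d)%N.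
Proof.
move=> d_gt0; rewrite -(@leq_pmul2l (totient d)) ?totient_gt0 //.
by rewrite -card_nl_order_add // leq_addl.
Qed.

Lemma card_nl_order d : (0 < d)%N ->
  #|[set j in nl G | ord j == d]| = (totient d * (a d - a' d))%N.
Proof. by move=> d_gt0; rewrite mulnBr -card_nl_order_add // addnK. Qed.

Lemma schur2_order2 j : j \in nl G -> schur_index j = 2%N -> ord j = 2%N.
Proof.
move=> nl_j s2; have [n Dn _] := nl_degree vz nl_j.
have [[s1 _ _]|[]//] := nl_cases nl_j Dn; by rewrite s2 in s1.
Qed.

Lemma card_order2 :
  (k + #|[set j in nl G | (ord j == 2%N) && (schur_index j != 2%N)]| = a 2 - a' 2)%N.
Proof.
have <- : #|[set j in nl G | ord j == 2%N]| = (a 2 - a' 2)%N.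
  by rewrite card_nl_order // mul1n.
rewrite -[RHS](cardsID [set j | schur_index j == 2%N]); congr (_ + _)%N; apply: eq_card => j.
  rewrite !in_set -andbA; case: (boolP ('chi_j 1%g != 1)) => //= nl1.
  have nl_j : j \in nl G by rewrite inE.
  by case: (eqVneq (schur_index j) 2%N) => [/(schur2_order2 nl_j)->|_]; rewrite ?eqxx ?andbF.
by rewrite !in_set [RHS]andbC -andbA.
Qed.

Lemma lin_order_dvd j : j \in ~: nl G -> (#['chi_j]%CF %| m1)%N.
Proof.
move=> lin_j; have d_gt0 : (0 < #['chi_j]%CF)%N by rewrite cforder_lin_char_gt0 -?in_nlC.
apply: nb_cyclic_exponent; have := card_lin_order d_gt0.
case: (aQ _) => // /eqP; rewrite muln0 cards_eq0 => /eqP E.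
have : j \in set0 by rewrite -E; apply/setIdP.
by rewrite inE.
Qed.

Lemma nl_order_dvd j : j \in nl G -> (ord j %| m2)%N.
Proof.
move=> nl_j; apply: nb_cyclic_exponent; have := card_nl_order (central_irr_order_gt0 j).
case: (a _) => // /eqP; rewrite sub0n muln0 cards_eq0 => /eqP E.
have : j \in set0 by rewrite -E; apply/setIdP.
by rewrite inE.
Qed.

Lemma nb_cyclic_ndvd d : ~~ (d %| m3)%N -> a' d = 0%N.
Proof. by apply: contraNeq; rewrite -lt0n; apply: nb_cyclic_exponent. Qed.

Lemma in_nl_set (P : pred (Iirr G)) j : (j \in [set j in nl G | P j]) = (j \in nl G) && P j.
Proof. by rewrite in_set. Qed.

Lemma realizes_nl_cat s1 s2 (P Q : pred (Iirr G)) :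
    realizes s1 [set j in nl G | P j] -> realizes s2 [set j in nl G | Q j] ->
    (forall j, j \in nl G -> P j -> ~~ Q j) ->
  realizes (s1 ++ s2) [set j in nl G | P j || Q j].
Proof.
move=> r1 r2 PQ; have -> : [set j in nl G | P j || Q j]
    = [set j in nl G | P j] :|: [set j in nl G | Q j].
  by apply/setP=> j; rewrite in_setU !in_nl_set andb_orr.
apply: realizes_cat => //.
rewrite -setI_eq0; apply/eqP/setP=> j; rewrite in_setI !in_nl_set in_set0.
case: (boolP (j \in nl G)) => //= nl_j.
by case: (boolP (P j)) => //= /(PQ j nl_j)/negPf.
Qed.

Lemma group_algebra_decomposition n : {in nl G, forall j, 'chi_j 1%g = n%:R} ->
  isomorphic_to_dsum QG
        (flatten [seq copies (aQ d) (Qzeta d) | d <- divisors m1]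
         ++ copies k (mxalg n./2 (quat rat))
         ++ copies (a 2 - a' 2 - k) (mxalg n rat^o)
         ++ flatten [seq copies (a d) (mxalg n (Qzeta d))
                     | d <- divisors m2 & (4 <= d)%N && ~~ (d %| m3)%N]
         ++ flatten [seq copies (a d - a' d) (mxalg n (Qzeta d))
                     | d <- divisors m2 & (4 <= d)%N && (d %| m3)%N]).
Proof.
move=> deg_n; apply: isomorphic_of_realizes.
have divisors_gt0 m d : (0 < m)%N -> d \in divisors m -> (0 < d)%N.
  by move=> m_gt0; rewrite -dvdn_divisors //; apply: dvdn_gt0.
have m1_gt0 := exponent_gt0 (G / G^`(1))%g; have m2_gt0 := exponent_gt0 Z.
have r1 := @realizes_flatten _ _ _ (divisors m1) (fun j => #['chi_j]%CF)
  (fun d => copies (aQ d) (Qzeta d)) (~: nl G) (divisors_uniq m1)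
  (fun d dm => realizes_lin (divisors_gt0 _ d m1_gt0 dm)).
have r2 := realizes_quat deg_n.
have r3 := realizes_rat deg_n (canRL (addKn _) card_order2).
have rfl (C : pred nat) b : (forall d, (0 < d)%N -> C d -> (4 <= d)%N /\
      #|[set j in nl G | ord j == d]| = (totient d * b d)%N) ->
    realizes (flatten [seq copies (b d) (mxalg n (Qzeta d)) | d <- [seq d <- divisors m2 | C d]])
      [set j in nl G | ord j \in [seq d <- divisors m2 | C d]].
  move=> HC; apply: (@realizes_flatten _ _ _ _ (fun j => ord j)
    (fun d => copies (b d) (mxalg n (Qzeta d))) (nl G)) => [|d].
    by rewrite filter_uniq ?divisors_uniq.
  rewrite mem_filter => /andP[Cd dm]; have d_gt0 := divisors_gt0 _ d m2_gt0 dm.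
  by have [d4 cardd] := HC d d_gt0 Cd; apply: realizes_nl.
have -> : setT = [set j in ~: nl G | #['chi_j]%CF \in divisors m1] :|:
    [set j in nl G | [|| schur_index j == 2%N, (ord j == 2%N) && (schur_index j != 2%N),
       ord j \in [seq d <- divisors m2 | (4 <= d)%N && ~~ (d %| m3)%N] |
       ord j \in [seq d <- divisors m2 | (4 <= d)%N && (d %| m3)%N]]].
  apply/esym/setP=> j; rewrite in_setT in_setU in_nl_set.
  have [nl_j|] := boolP (j \in nl G); last first.
    rewrite -in_setC orbF => lin_j; apply/setIdP; split=> //.
    by rewrite -dvdn_divisors // lin_order_dvd.
  rewrite !mem_filter -!dvdn_divisors // nl_order_dvd //= !andbT orbC.
  have [->|->] := nl_order_pow nl_j; last by case: (_ %| m3)%N; rewrite ?orbT.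
  by case: (schur_index j == 2%N).
apply: realizes_cat; first exact: r1.
  apply: realizes_nl_cat => //; last first.
    move=> j nl_j /eqP s2; rewrite !mem_filter s2 eqxx andbF /=.
    by rewrite (schur2_order2 nl_j s2).
  apply: realizes_nl_cat => //; last first.
    by move=> j nl_j /andP[/eqP o2 _]; rewrite !mem_filter o2.
  apply: realizes_nl_cat.
  - apply: rfl => d d_gt0 /andP[-> ndvd]; split=> //.
    by rewrite card_nl_order // (nb_cyclic_ndvd ndvd) subn0.
  - by apply: rfl => d d_gt0 /andP[-> _]; split=> //; rewrite card_nl_order.
  move=> j _; rewrite !mem_filter => /andP[/andP[_ /negPf->] _].
  by rewrite andbF.
rewrite -setI_eq0; apply/eqP/setP=> j; rewrite in_setI in_nl_set in_set0.
apply/andP=> -[/setIdP[]]; rewrite in_setC => /negPf-> //.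
Qed.

End Decomposition.

Close Scope ring_scope.
Close Scope group_scope.

Theorem theorem2 (gT : finGroupType) (G : {group gT}) :
  (2.-group G)%g -> VZ_group G ->
  let m1 := exponent (G / G^`(1))%g in
  let m2 := exponent 'Z(G)%g in
  let m3 := exponent ('Z(G) / G^`(1))%g in
  let k := #|[set i in nl G | schur_index i == 2]| in
  let aQ := nb_cyclic (G / G^`(1))%g in
  let a := nb_cyclic 'Z(G)%g in
  let a' := nb_cyclic ('Z(G) / G^`(1))%g in
  exists2 n, n ^ 2 = #|(G / 'Z(G))%g| &
  [/\ a' 2 + k <= a 2,
      forall d, 4 <= d -> d %| m2 -> d %| m3 -> a' d <= a d
    & isomorphic_to_dsum (galg rat (subg_of G))
        (flatten [seq copies (aQ d) (Qzeta d) | d <- divisors m1]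
         ++ copies k (mxalg n./2 (quat rat))
         ++ copies (a 2 - a' 2 - k) (mxalg n rat^o)
         ++ flatten [seq copies (a d) (mxalg n (Qzeta d))
                     | d <- divisors m2 & (4 <= d) && ~~ (d %| m3)]
         ++ flatten [seq copies (a d - a' d) (mxalg n (Qzeta d))
                     | d <- divisors m2 & (4 <= d) && (d %| m3)])].
Proof.
move=> pG vz m1 m2 m3 k aQ a a'.
have [n cardn deg_n] := degree_exists vz; exists n => //.
have card2 := card_order2 vz pG.
have le_a2 : a' 2 <= a 2 := @nb_cyclic_center_leq _ _ vz 2 isT.
split=> [|d d4 _ _|].
- by rewrite -(subnKC le_a2) leq_add2l -card2 leq_addr.
- by apply: (nb_cyclic_center_leq vz); apply: leq_trans d4.
exact: group_algebra_decomposition.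
Qed.
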